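(* Let $m\ge3$. The minimum net total curvature $\mathrm{NTC}(\{W_m\})$ for graphs in $\mathbb{R}^3$ homeomorphic to the wheel $W_m$ equals $\pi\big(2+\lceil\frac m2\rceil\big)$.
   Context: $W_m$ is the ''wheel'' of $m$ spokes: a cycle $C$ containing $m$ vertices $v_1,\dots,v_m$ (the rim), a central vertex $w$ (the hub) not on $C$, and edges $E_i$ (the spokes) connecting $w$ to $v_i$, $1\le i\le m$. Mappings $f$ of a finite graph $\Gamma$ into $\mathbb{R}^n$ are piecewise $C^2$: after adding finitely many degree-2 vertices, each edge is mapped as a regular $C^2$ arc up to its endpoints; $f$ need not be an embedding. Net total curvature: at a vertex $q$ of degree $d$ with unit tangent vectors $T_1,\dots,T_d\in S^{n-1}$ pointing into the edges ending at $q$, let $\chi_i:S^{n-1}\to\{\pm1\}$ be $-1$ where $\langle e,T_i\rangle>0$ and $+1$ where $\langle e,T_i\rangle<0$ (a.e.). Set $\mathrm{ntc}(q)=\pi$ times the average over $e\in S^{n-1}$ of $\big[\sum_{i=1}^d\chi_i(e)\big]^+$ (for $n=3$ this is $\frac14\int_{S^2}[\sum_i\chi_i]^+dA$; for $n=1$ the average is over $S^0=\{\pm1\}$), and $\mathrm{NTC}(f)=\sum_q\mathrm{ntc}(q)+\int|\vec k|\,ds$, the sum over all vertices (including those of degree 2) and the integral of the curvature over the open $C^2$ edges. $\mathrm{NTC}(\{\Gamma\})$ is the infimum (''minimum value for the topological type'') of $\mathrm{NTC}(f)$ over all mappings $f:\Gamma\to\mathbb{R}^n$ (all $n$). *)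

(* Defs.v *)
From HB Require Import structures.
From mathcomp Require Import all_boot all_order all_algebra.
From mathcomp Require Import all_classical all_reals all_analysis.

Set Implicit Arguments.
Unset Strict Implicit.
Unset Printing Implicit Defensive.

Import Order.TTheory GRing.Theory Num.Theory.
Import numFieldNormedType.Exports.

Local Open Scope classical_set_scope.
Local Open Scope ring_scope.

(* The library norm on 'rV[R]_n is the max norm; every metric notion below
   uses the Euclidean inner product and norm instead. *)
Definition dot {R : realType} {n : nat} (u v : 'rV[R]_n) : R :=
  \sum_(i < n) u 0 i * v 0 i.

Definition enorm {R : realType} {n : nat} (u : 'rV[R]_n) : R :=
  Num.sqrt (dot u u).

(* Lebesgue integral over R^n of a nonnegative Borel function, as an iterated
   one-dimensional integral (Tonelli). *)
Fixpoint integral_rV {R : realType} (n : nat) :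
    ('rV[R]_n -> \bar R) -> \bar R :=
  match n with
  | 0%N => fun F => F 0
  | k.+1 => fun F =>
      (\int[@lebesgue_measure R]_x
         integral_rV (fun v : 'rV[R]_k => F (row_mx (x%:M : 'rV[R]_1) v)))%E
  end.

(* Average of a nonnegative function over S^(n-1) for the normalized surface
   measure A |-> vol {t u | u in A, 0 < t <= 1} / vol B^n: the average over
   the unit ball of the radial extension of h. For n = 1 it is
   (h 1 + h (-1)) / 2. *)
Definition sphere_avg {R : realType} (n : nat) (h : 'rV[R]_n -> R) : R :=
  let B := [set x : 'rV[R]_n | enorm x <= 1] in
  fine (integral_rV (fun x => (h ((enorm x)^-1 *: x) * \1_B x)%:E)) /
  fine (integral_rV (fun x => (\1_B x)%:E)).

(* Finite graphs, loops and multiple edges allowed. The orientation of an edge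
   only records the direction in which it is parametrized. *)
Record graph := Graph {
  vertex : finType;
  edge : finType;
  tail : edge -> vertex;
  head : edge -> vertex }.

Section Subdivision.
Variables (G : graph) (k : edge G -> nat).

(* subdivide k: the edge a is replaced by a path of (k a).+1 edges through
   k a new vertices of degree 2, listed from tail a to head a. *)
Definition sub_vertex : finType := (vertex G + {a : edge G & 'I_(k a)})%type.

Definition sub_edge : finType := {a : edge G & 'I_(k a).+1}.

Definition sub_tail (b : sub_edge) : sub_vertex :=
  let: existT a i := b in
  if unlift ord0 i is Some j then inr (existT _ a j) else inl (tail a).

Definition sub_head (b : sub_edge) : sub_vertex :=
  let: existT a i := b in
  if unlift ord_max i is Some j then inr (existT _ a j) else inl (head a).

Definition subdivide : graph := Graph sub_tail sub_head.

End Subdivision.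

(* wheel m: None is the hub and Some i are the vertices on the rim; inl i is
   the spoke from the hub to Some i, inr i the arc of the rim from Some i to
   its cyclic successor. *)
Definition wheel (m : nat) : graph :=
  @Graph (option 'I_m) ('I_m + 'I_m)%type
    (fun a => match a with inl _ => None | inr i => Some i end)
    (fun a => match a with inl i => Some i | inr i => Some (ordS i) end).

Section NetTotalCurvature.
Context {R : realType} {n : nat}.

Definition C2 (g : R -> 'rV[R]_n) : Prop :=
  [/\ forall t, derivable g t 1,
      forall t, derivable (derive1 g) t 1 &
      continuous (derive1 (derive1 g))].

(* Each edge is a regular arc parametrized by [0, 1]; being C^2 up to the
   endpoints is expressed by an extension of the parametrization that is C^2
   on R. Only the restriction to [0, 1] matters: the derivatives at 0 and 1
   are the one-sided ones. Arcs may meet or overlap. *)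
Record drawing (G : graph) := Drawing {
  pos : vertex G -> 'rV[R]_n;
  arc : edge G -> R -> 'rV[R]_n;
  arc_C2 : forall a, C2 (arc a);
  arc_regular : forall a t, 0 <= t <= 1 -> derive1 (arc a) t != 0;
  arc_tail : forall a, arc a 0 = pos (tail a);
  arc_head : forall a, arc a 1 = pos (head a) }.

Definition unit_tangent (g : R -> 'rV[R]_n) (t : R) : 'rV[R]_n :=
  (enorm (derive1 g t))^-1 *: derive1 g t.

(* k = dT/ds, where ds = |g'| dt. *)
Definition curvature_vector (g : R -> 'rV[R]_n) (t : R) : 'rV[R]_n :=
  (enorm (derive1 g t))^-1 *: derive1 (unit_tangent g) t.

Definition arc_curvature (g : R -> 'rV[R]_n) : R :=
  \int[@lebesgue_measure R]_(t in `[0, 1])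
    (enorm (curvature_vector g t) * enorm (derive1 g t)).

Definition chi (T e : 'rV[R]_n) : R := - Num.sg (dot e T).

(* Sum over the edge ends at q, so that a loop counts twice; the unit tangent
   pointing into an edge at its head is the opposite of its final velocity
   direction. *)
Definition chi_sum (G : graph) (f : drawing G) (q : vertex G)
    (e : 'rV[R]_n) : R :=
  \sum_(a | tail a == q) chi (unit_tangent (arc f a) 0) e +
  \sum_(a | head a == q) chi (- unit_tangent (arc f a) 1) e.

Definition ntc (G : graph) (f : drawing G) (q : vertex G) : R :=
  pi * sphere_avg (fun e => Num.max 0 (chi_sum f q e)).

Definition drawing_NTC (G : graph) (f : drawing G) : R :=
  \sum_(q : vertex G) ntc f q + \sum_(a : edge G) arc_curvature (arc f a).

(* Piecewise C^2 mappings of G into R^n. *)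
Record pw_mapping (G : graph) := PwMapping {
  added : edge G -> nat;
  pw_drawing : drawing (subdivide added) }.

Definition NTC (G : graph) (f : pw_mapping G) : R :=
  drawing_NTC (pw_drawing f).

End NetTotalCurvature.

Arguments drawing : clear implicits.
Arguments pw_mapping : clear implicits.

Definition NTC_type (R : realType) (G : graph) : R :=
  inf [set x | exists (n : nat) (f : pw_mapping R n G), x = NTC f].

Definition NTC_type_in (R : realType) (n : nat) (G : graph) : R :=
  inf [set x | exists f : pw_mapping R n G, x = NTC f].

(* Main.v *)
From HB Require Import structures.
From mathcomp Require Import all_boot all_order all_algebra.
From mathcomp Require Import all_classical all_reals all_analysis.
From mathcomp Require Import measurable_realfun.
From mathcomp Require Import zify ring lra.
Require Import Defs.

Set Implicit Arguments.
Unset Strict Implicit.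
Unset Printing Implicit Defensive.

Import Order.TTheory GRing.Theory Num.Theory.
Import numFieldNormedType.Exports.

Local Open Scope classical_set_scope.
Local Open Scope ring_scope.

(** Averaging over directions turns net total curvature into a count. For a
    unit vector [e], let [chi_q(e)] be the sum of the signs [chi] at the
    vertex [q]. Since [chi_q] is odd in [e], the positive part in the
    definition of [ntc] may be replaced by half the absolute value: [ntc q]
    is [pi / 2] times the mean of [|chi_q|] ([ntcE]). Similarly the total
    curvature of an arc with unit tangent [T] dominates [pi / 2] times the
    mean of the variation of the sign of [<e, T>] between dyadic times
    ([ball_mean_variation]); this is the inequality in the formula of
    Crofton.

    Lower bound. Fix a direction [e] generic for the drawing and consider
    the height [<e, f>] on the compact image. At a vertex of degree [d],
    [chi_q] is an integer of the parity of [d], so its absolute value is at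
    least 1 when [d] is odd. If the height is maximal at [q] then all edges
    go down from [q], and [chi_q = d]; for a minimum, [chi_q = - d]. As [d
    >= 2], both cases exceed the parity bound by at least 2. If the maximum
    is interior to an arc, the sign of [<e, T>] falls from 1 to -1 along
    that arc, for a minimum it rises, and each contributes 2 to the
    variation ([top_alternative], [sign_variation_ge]). So the sum of all
    [|chi_q|] and all variations is at least the number of odd vertices plus
    4, and the net total curvature of any drawing of a graph without
    vertices of degree 0 or 1 is at least [pi / 2] times that number
    ([NTC_lower_bound]). A wheel, subdivided or not, has [m] rim vertices of
    degree 3 and a hub of degree [m]: this gives [pi / 2 * (m + odd m + 4) =
    pi * (2 + ceil (m / 2))].

    The bound is attained by a drawing on a line ([linear_mapping]): the
    [i]-th rim vertex is at height [i], and the hub is at a height that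
    separates the rim into halves. Then the two extreme rim vertices have
    [|chi_q| = 3], the others [1], and the hub [odd m].

    The measure theory is done with the measure [row_measure] behind the
    iterated integral [integral_rV]. What has to be known about it is that
    it is invariant under the reflections in hyperplanes
    ([volume_preserving_reflection]); they are products of shears and of
    reflections of one coordinate, for which the theorem of Fubini and
    Tonelli suffices. For the inequality of Crofton, the probability that
    [<e, u>] and [<e, v>] differ in sign ([sign_dist]) is additive along
    great circles and at most 1, so it is at most [t / (pi - t)] for
    directions at angle [t]; this is asymptotically sharp as [t] tends to 0,
    and one sums over fine subdivisions of the tangent indicatrix
    ([sign_dist_path]). *)

(** * Lebesgue measure on row vectors *)

Section measurable_row.
Context {R : realType} (n : nat).

Let coord (i : 'I_n) (x : 'rV[R]_n) : measurableTypeR R := x 0 i.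

Let row_set0 : g_sigma_preimage coord set0.
Proof. exact: sigma_algebra0. Qed.

Let row_setC A : g_sigma_preimage coord A -> g_sigma_preimage coord (~` A).
Proof. exact: sigma_algebraC. Qed.

Let row_bigcup (F : _^nat) : (forall i, g_sigma_preimage coord (F i)) ->
  g_sigma_preimage coord (\bigcup_i (F i)).
Proof. exact: sigma_algebra_bigcup. Qed.

HB.instance Definition _ := @isMeasurable.Build default_measure_display
  'rV[R]_n (g_sigma_preimage coord) row_set0 row_setC row_bigcup.

Lemma measurable_coord (i : 'I_n) :
  measurable_fun [set: 'rV[R]_n] (fun x => x 0 i).
Proof.
move=> _ Y mY; rewrite setTI; apply: sub_sigma_algebra => /=.
rewrite -bigcup_seq/=; exists i => /=; first by rewrite mem_index_enum.
by exists Y => //; rewrite setTI.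
Qed.

Lemma measurable_fun_row d (T : measurableType d) (f : T -> 'rV[R]_n) :
  (forall i, measurable_fun [set: T] (fun t => f t 0 i)) ->
  measurable_fun [set: T] f.
Proof.
move=> mf.
suff h : g_sigma_preimage (fun i => coord i \o f) `<=` measurable.
  move=> _ A mA; rewrite setTI; apply: h.
  rewrite g_sigma_preimage_comp.
  by exists A => //; rewrite setTI.
apply: smallest_sub; first exact: sigma_algebra_measurable.
rewrite -bigcup_seq => A [i _ [B mB <-]].
exact: mf.
Qed.

End measurable_row.

Section row_cons.
Context {R : realType}.

Definition row_cons k (x : R) (v : 'rV[R]_k) : 'rV[R]_k.+1 :=
  row_mx (x%:M : 'rV[R]_1) v.

Definition row_behead k (x : 'rV[R]_k.+1) : 'rV[R]_k := \row_i x 0 (lift 0 i).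

Lemma row_consE0 k x (v : 'rV[R]_k) : row_cons x v 0 0 = x.
Proof.
rewrite /row_cons mxE; case: splitP => [j _|j]; last by move=> /= /eqP.
by rewrite mxE !ord1 eqxx mulr1n.
Qed.

Lemma row_consES k x (v : 'rV[R]_k) i : row_cons x v 0 (lift 0 i) = v 0 i.
Proof.
rewrite /row_cons mxE; case: splitP => [j|j]; first by rewrite ord1.
by rewrite /= /bump/= add1n => -[] /val_inj ->.
Qed.

Lemma row_consP k (x : 'rV[R]_k.+1) : row_cons (x 0 0) (row_behead x) = x.
Proof.
apply/rowP => i; case: (unliftP 0 i) => [j ->|->].
  by rewrite row_consES mxE.
by rewrite row_consE0.
Qed.

Lemma row_behead_cons k x (v : 'rV[R]_k) : row_behead (row_cons x v) = v.
Proof. by apply/rowP => i; rewrite mxE row_consES. Qed.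

Lemma dot_row_cons k x y (u v : 'rV[R]_k) :
  dot (row_cons x u) (row_cons y v) = x * y + dot u v.
Proof.
rewrite /dot big_ord_recl !row_consE0; congr (_ + _).
by apply: eq_bigr => i _; rewrite !row_consES.
Qed.

Lemma measurable_row_cons d (T : measurableType d) k (f : T -> R)
    (g : T -> 'rV[R]_k) :
  measurable_fun setT f -> measurable_fun setT g ->
  measurable_fun setT (fun t => row_cons (f t) (g t)).
Proof.
move=> mf mg; apply: measurable_fun_row => i.
case: (unliftP 0 i) => [j ->|->].
  under eq_fun do rewrite row_consES.
  exact: (measurableT_comp (measurable_coord j) mg).
by under eq_fun do rewrite row_consE0.
Qed.

Lemma measurable_row_behead k :
  measurable_fun setT (@row_behead k).
Proof.
apply: measurable_fun_row => i.
under eq_fun do rewrite mxE.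
exact: measurable_coord.
Qed.

End row_cons.

Section row_measure.
Context {R : realType}.
Notation leb := (@lebesgue_measure R).

Section step.
Variables (k : nat) (mu : {sigma_finite_measure set 'rV[R]_k -> \bar R}).

Let consp (p : measurableTypeR R * 'rV[R]_k) : 'rV[R]_k.+1 :=
  row_cons p.1 p.2.

Let mconsp : measurable_fun setT consp.
Proof. by apply: measurable_row_cons => //; exact: measurable_fst. Qed.

(** The image of the product of Lebesgue measure and [mu]: one step of the
    recursion that defines [integral_rV]. *)
Definition row_measure_step : set 'rV[R]_k.+1 -> \bar R :=
  pushforward (leb \x mu)%E consp.

HB.instance Definition _ := Measure.copy row_measure_step
  (measure_function_pushforward__canonical__measure_function_Measure
     (leb \x mu)%E mconsp).

Let step_sigma_finite : sigma_finite setT row_measure_step.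
Proof.
have /sigma_finiteP[F [TF ndF Foo]] := sigma_finiteT leb.
have /sigma_finiteP[G [TG ndG Goo]] := sigma_finiteT mu.
exists (fun n => (fun x : 'rV[R]_k.+1 => x 0 0) @^-1` F n `&` @row_behead R k
  @^-1` G n).
  apply/esym; rewrite -subTset => x _.
  have [i _ Fi] : (\bigcup_i F i) (x 0 0) by rewrite -TF.
  have [j _ Gj] : (\bigcup_j G j) (row_behead x) by rewrite -TG.
  exists (maxn i j) => //; split => /=.
    by move: Fi; exact/subsetPset/ndF/leq_maxl.
  by move: Gj; exact/subsetPset/ndG/leq_maxr.
move=> n; have [mF Fn] := Foo n; have [mG Gn] := Goo n; split.
  apply: measurableI.
    by rewrite -[X in measurable X]setTI; exact: measurable_coord.
  by rewrite -[X in measurable X]setTI; exact: measurable_row_behead.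
rewrite /row_measure_step /pushforward (_ : _ @^-1` _ = F n `*` G n).
  by rewrite product_measure1E// lte_mul_pinfty// ge0_fin_numE.
by apply/seteqP; split => -[x v] /=; rewrite row_consE0 row_behead_cons.
Qed.

HB.instance Definition _ := Measure_isSigmaFinite.Build _ _ _ row_measure_step
  step_sigma_finite.

Lemma integral_row_measure_step (F : 'rV[R]_k.+1 -> \bar R) :
  measurable_fun setT F -> (forall x, 0 <= F x)%E ->
  (\int[row_measure_step]_x F x = \int[leb]_x \int[mu]_v F (row_cons x v))%E.
Proof.
move=> mF F0.
rewrite ge0_integral_pushforward// preimage_setT.
have mFc : measurable_fun setT (F \o consp) by exact: measurableT_comp mF
  mconsp.
by rewrite fubini_tonelli1// => x; exact: F0.
Qed.

End step.

Lemma row_measure_subproof n :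
  exists mu : {sigma_finite_measure set 'rV[R]_n -> \bar R},
  forall F : 'rV[R]_n -> \bar R, measurable_fun setT F ->
    (forall x, 0 <= F x)%E -> integral_rV F = (\int[mu]_x F x)%E.
Proof.
elim: n => [|k [mu IH]].
  exists (\d_(0 : 'rV[R]_0)) => F mF F0 /=.
  by rewrite integral_dirac ?diracT ?mul1e.
exists (row_measure_step mu) => F mF F0 /=.
rewrite integral_row_measure_step//.
apply: eq_integral => x _; apply: IH => //.
apply: (measurableT_comp mF).
exact: measurable_row_cons.
Qed.

Definition row_measure n : {sigma_finite_measure set 'rV[R]_n -> \bar R} :=
  proj1_sig (cid (row_measure_subproof n)).

Lemma integral_rVE n (F : 'rV[R]_n -> \bar R) : measurable_fun setT F ->
  (forall x, 0 <= F x)%E -> integral_rV F = (\int[row_measure n]_x F x)%E.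
Proof. exact: (proj2_sig (cid (row_measure_subproof n))). Qed.

End row_measure.

(** * The Euclidean inner product and affine changes of variable *)

Section dot_theory.
Context {R : realType} {n : nat}.
Implicit Types u v w : 'rV[R]_n.

Lemma dotC u v : dot u v = dot v u.
Proof. by apply: eq_bigr => i _; rewrite mulrC. Qed.

Lemma dotDl u v w : dot (u + v) w = dot u w + dot v w.
Proof. by rewrite -big_split; apply: eq_bigr => i _; rewrite mxE mulrDl. Qed.

Lemma dotZl c u w : dot (c *: u) w = c * dot u w.
Proof. by rewrite mulr_sumr; apply: eq_bigr => i _; rewrite mxE mulrA. Qed.

Lemma dotNl u w : dot (- u) w = - dot u w.
Proof. by rewrite -scaleN1r dotZl mulN1r. Qed.

Lemma dotBl u v w : dot (u - v) w = dot u w - dot v w.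
Proof. by rewrite dotDl dotNl. Qed.

Lemma dotDr u v w : dot u (v + w) = dot u v + dot u w.
Proof. by rewrite ![dot u _]dotC dotDl. Qed.

Lemma dotZr c u w : dot u (c *: w) = c * dot u w.
Proof. by rewrite ![dot u _]dotC dotZl. Qed.

Lemma dotNr u w : dot u (- w) = - dot u w.
Proof. by rewrite ![dot u _]dotC dotNl. Qed.

Lemma dotBr u v w : dot u (v - w) = dot u v - dot u w.
Proof. by rewrite dotDr dotNr. Qed.

Lemma dot0l u : dot 0 u = 0.
Proof. by rewrite -(scale0r 0) dotZl mul0r. Qed.

Lemma dot_ge0 u : 0 <= dot u u.
Proof. by apply: sumr_ge0 => i _; rewrite -expr2 sqr_ge0. Qed.

Lemma dot_eq0 u : (dot u u == 0) = (u == 0).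
Proof.
apply/eqP/eqP => [|->]; last by rewrite dot0l.
move=> /eqP; rewrite psumr_eq0; last by move=> i _; rewrite -expr2 sqr_ge0.
move=> /allP h; apply/rowP => i; rewrite mxE; apply/eqP.
by have := h i; rewrite mem_index_enum -expr2 sqrf_eq0; exact.
Qed.

Lemma enorm_ge0 u : 0 <= enorm u.
Proof. exact: sqrtr_ge0. Qed.

Lemma enorm_sqr u : enorm u ^+ 2 = dot u u.
Proof. by rewrite sqr_sqrtr ?dot_ge0. Qed.

Lemma enorm_eq0 u : (enorm u == 0) = (u == 0).
Proof. by rewrite -sqrf_eq0 enorm_sqr dot_eq0. Qed.

Lemma enorm_gt0 u : (0 < enorm u) = (u != 0).
Proof. by rewrite lt_neqAle enorm_ge0 andbT eq_sym enorm_eq0. Qed.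

Lemma dot_normalized u : u != 0 ->
  dot ((enorm u)^-1 *: u) ((enorm u)^-1 *: u) = 1.
Proof.
move=> u0; rewrite dotZl dotZr mulrA -enorm_sqr -invfM -expr2 mulVf//.
by rewrite sqrf_eq0 enorm_eq0.
Qed.

(** Cauchy-Schwarz: expand [0 <= |u|^2 |v - (<u,v>/|u|^2) u|^2]. *)
Lemma dot_le_enorm u v : dot u v <= enorm u * enorm v.
Proof.
have [->|u0] := eqVneq u 0; first by rewrite dot0l mulr_ge0 ?enorm_ge0.
have uu : 0 < dot u u by rewrite -enorm_sqr exprn_gt0 ?enorm_gt0.
rewrite (le_trans (ler_norm _))// -(@ler_pXn2r _ 2)// ?nnegrE ?mulr_ge0
  ?enorm_ge0//.
rewrite exprMn !enorm_sqr real_normK ?num_real//.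
have := dot_ge0 (dot u u *: v - dot u v *: u).
rewrite dotBl !dotBr !dotZl !dotZr (dotC v u) => h.
rewrite -subr_ge0 -(pmulr_rge0 _ uu); move: h; congr (0 <= _).
ring.
Qed.

Lemma measurable_dot d (T : measurableType d) (f : T -> 'rV[R]_n) w :
  measurable_fun setT f -> measurable_fun setT (fun t => dot (f t) w).
Proof.
move=> mf; apply: measurable_sum => i; apply: measurable_funM => //.
exact: (measurableT_comp (measurable_coord i) mf).
Qed.

Lemma measurable_enorm : measurable_fun setT (@enorm R n).
Proof.
apply: (measurableT_comp (continuous_measurable_fun (@sqrt_continuous R))).
by apply: measurable_sum => i; apply: measurable_funM; exact: measurable_coord.
Qed.

Lemma measurable_rowD d (T : measurableType d) (f g : T -> 'rV[R]_n) :
  measurable_fun setT f -> measurable_fun setT g ->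
  measurable_fun setT (fun t => f t + g t).
Proof.
move=> mf mg; apply: measurable_fun_row => i; under eq_fun do rewrite mxE.
by apply: measurable_funD; apply: (measurableT_comp (measurable_coord i)).
Qed.

Lemma measurable_rowZ d (T : measurableType d) (f : T -> R) w :
  measurable_fun setT f -> measurable_fun setT (fun t => f t *: w).
Proof.
move=> mf; apply: measurable_fun_row => i; under eq_fun do rewrite mxE.
exact: measurable_funM.
Qed.

End dot_theory.

Section lebesgue_affine.
Context {R : realType}.
Notation leb := (@lebesgue_measure R).

Lemma ge0_integral_lebesgueD c (f : R -> \bar R) : measurable_fun setT f ->
  (forall x, 0 <= f x)%E -> (\int[leb]_x f (x + c)%R = \int[leb]_x f x)%E.
Proof.
move=> mf f0.
have mc : measurable_fun [set: measurableTypeR R]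
  ((fun x => x + c) : _ -> measurableTypeR R) by exact: measurable_funD.
rewrite -[LHS]/(\int[leb]_(x in (fun y : measurableTypeR R => (y + c)%R :
  measurableTypeR R) @^-1` setT) (f \o (fun y => y + c)%R) x)%E.
rewrite -ge0_integral_pushforward//.
apply: eq_measure_integral => A mA _; apply/esym.
apply: lebesgue_measure_unique => //= _ [[a b]] _ <-.
rewrite /pushforward (_ : _ @^-1` _ = `]a - c, b - c]%classic); last first.
  by apply/seteqP; split => x /=; rewrite !in_itv/= ltrBlDr lerBrDr.
rewrite !lebesgue_measure_itv/= !lte_fin ltrD2r -!EFinB.
by congr (if _ then _%:E else _); ring.
Qed.

Lemma ge0_integral_lebesgue_reflect c (f : R -> \bar R) :
  measurable_fun setT f -> (forall x, 0 <= f x)%E ->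
  (\int[leb]_x f (c - x)%R = \int[leb]_x f x)%E.
Proof.
move=> mf f0.
rewrite -(ge0_integral_lebesgueD c mf f0) /=.
have mfc : measurable_fun setT (fun x : R => f (x + c)).
  by apply: (measurableT_comp mf); exact: measurable_funD.
transitivity (\int[leb]_(x in -%R @^-1` setT)
                 ((fun x => f (x + c)%R) \o -%R) x)%E.
  by apply: eq_integral => x _ /=; rewrite addrC.
rewrite -(@ge0_integral_pushforward _ _ (measurableTypeR R) (measurableTypeR
  R))//.
apply: eq_measure_integral => A mA _; exact: lebesgue_measureN.
Qed.

End lebesgue_affine.

(** * Volume is invariant under reflections *)

Section row_measure_invariance.
Context {R : realType}.
Notation leb := (@lebesgue_measure R).

(** The measurability is part of the notion so that it is closed under
    composition. *)
Definition volume_preserving n (g : 'rV[R]_n -> 'rV[R]_n) : Prop :=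
  measurable_fun setT g /\
  forall F : 'rV[R]_n -> \bar R, measurable_fun setT F ->
    (forall x, 0 <= F x)%E ->
    (\int[row_measure n]_x F (g x) = \int[row_measure n]_x F x)%E.

Lemma volume_preserving_comp n (g h : 'rV[R]_n -> 'rV[R]_n) :
  volume_preserving g -> volume_preserving h -> volume_preserving (g \o h).
Proof.
move=> [mg ig] [mh ih]; split; first exact: (measurableT_comp mg mh).
move=> F mF F0; rewrite -(ig F)//.
by apply: (ih (F \o g)) => [|x]; [exact: (measurableT_comp mF mg)|exact: F0].
Qed.

Section slices.
Variables (k : nat) (F : 'rV[R]_k.+1 -> \bar R).
Hypotheses (mF : measurable_fun setT F) (F0 : (forall x, 0 <= F x)%E).

Lemma integral_row_measureS :
  (\int[row_measure k.+1]_x F x =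
   \int[leb]_x \int[row_measure k]_v F (row_cons x v))%E.
Proof.
rewrite -integral_rVE//=; apply: eq_integral => x _; apply: integral_rVE => //.
by apply: (measurableT_comp mF); exact: measurable_row_cons.
Qed.

Lemma integral_row_measureS_swap :
  (\int[row_measure k.+1]_x F x =
   \int[row_measure k]_v \int[leb]_x F (row_cons x v))%E.
Proof.
rewrite integral_row_measureS.
pose G (p : measurableTypeR R * 'rV[R]_k) := F (row_cons p.1 p.2).
have mG : measurable_fun setT G.
  by apply: (measurableT_comp mF); apply: measurable_row_cons => //;
    exact: measurable_fst.
by apply: (fubini_tonelli G) => // p; exact: F0.
Qed.

End slices.

Lemma volume_preserving_slices k (g : 'rV[R]_k.+1 -> 'rV[R]_k.+1)
    (h : R -> 'rV[R]_k -> 'rV[R]_k) :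
  measurable_fun setT g ->
  (forall x v, g (row_cons x v) = row_cons x (h x v)) ->
  (forall x, volume_preserving (h x)) -> volume_preserving g.
Proof.
move=> mg gE hP; split => // F mF F0.
have mFg : measurable_fun setT (F \o g) by exact: measurableT_comp mF mg.
rewrite (integral_row_measureS mF F0).
rewrite (integral_row_measureS mFg (fun x => F0 (g x))) /=.
apply: eq_integral => x _.
under eq_integral do rewrite gE.
apply: (hP x).2 (fun v => F (row_cons x v)) _ _ => // .
by apply: (measurableT_comp mF); exact: measurable_row_cons.
Qed.

Lemma volume_preserving_fibers k (g : 'rV[R]_k.+1 -> 'rV[R]_k.+1)
    (l : 'rV[R]_k -> R) :
  measurable_fun setT g ->
  (forall x v, g (row_cons x v) = row_cons (l v - x) v) ->
  volume_preserving g.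
Proof.
move=> mg gE; split => // F mF F0.
have mFg : measurable_fun setT (F \o g) by exact: measurableT_comp mF mg.
rewrite (integral_row_measureS_swap mF F0).
rewrite (integral_row_measureS_swap mFg (fun x => F0 (g x))) /=.
apply: eq_integral => v _.
under eq_integral do rewrite gE.
apply: (ge0_integral_lebesgue_reflect (l v) (f := fun x => F (row_cons x v)))
  => //.
by apply: (measurableT_comp mF); exact: measurable_row_cons.
Qed.

Lemma row_consD k (x y : R) (u v : 'rV[R]_k) :
  row_cons x u + row_cons y v = row_cons (x + y) (u + v).
Proof.
by apply/rowP => i; rewrite mxE; case: (unliftP 0 i) => [j|] ->;
  rewrite ?row_consES ?row_consE0 ?mxE.
Qed.

Lemma row_consZ k (c x : R) (u : 'rV[R]_k) :
  c *: row_cons x u = row_cons (c * x) (c *: u).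
Proof.
by apply/rowP => i; rewrite mxE; case: (unliftP 0 i) => [j|] ->;
  rewrite ?row_consES ?row_consE0 ?mxE.
Qed.

Lemma volume_preserving_translation n (c : 'rV[R]_n) :
  volume_preserving (fun x => x + c).
Proof.
elim: n c => [|k IH] c.
  split; first exact: measurable_rowD.
  by move=> F mF F0; apply: eq_integral => x _;
    rewrite [x + c]thinmx0 [x]thinmx0.
pose g (x : 'rV[R]_k.+1) := x + row_cons (c 0 0) 0.
pose h (x : 'rV[R]_k.+1) := x + row_cons 0 (row_behead c).
have -> : (fun x => x + c) = g \o h.
  apply/funext => x; rewrite /g /h /= -addrA row_consD addr0 add0r.
  by rewrite -[X in x + X]row_consP.
apply: volume_preserving_comp.
  have mg : measurable_fun setT g by exact: measurable_rowD.
  split => // F mF F0.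
  have mFg : measurable_fun setT (F \o g) by exact: measurableT_comp mF mg.
  rewrite (integral_row_measureS_swap mF F0).
  rewrite (integral_row_measureS_swap mFg (fun x => F0 (g x))) /=.
  apply: eq_integral => v _.
  rewrite -(ge0_integral_lebesgueD (c 0 0) (f := fun x => F (row_cons x v)))//.
    by apply: eq_integral => x _; rewrite /g row_consD addr0.
  by apply: (measurableT_comp mF); exact: measurable_row_cons.
apply: (volume_preserving_slices (h := fun=> fun v => v + row_behead c)) => //.
  exact: measurable_rowD.
by move=> x v; rewrite /h row_consD addr0.
Qed.

Definition reflection n (w x : 'rV[R]_n) : 'rV[R]_n := x - (2 * dot x w) *: w.

Lemma measurable_reflection n (w : 'rV[R]_n) :
  measurable_fun setT (reflection w).
Proof.
rewrite /reflection; under eq_fun do rewrite -scaleNr.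
apply: measurable_rowD => //; apply: measurable_rowZ;
  apply: measurableT_comp => //.
apply: measurable_funM => //; exact: measurable_dot.
Qed.

(** By induction on the dimension, for [w = (a, w')]. If [a = 0] the
    reflection acts on each slice as the reflection of [w']. Otherwise the
    shear [S] that adds [x / a] times [w'] to the last coordinates sends the
    first basis vector to a multiple of [w], so [S^-1] conjugates the
    reflection to a map that moves only the first coordinate, namely [x |->
    l(v) - x] on the fiber of [v]. *)
Lemma volume_preserving_reflection n (w : 'rV[R]_n) :
  dot w w = 1 -> volume_preserving (reflection w).
Proof.
elim: n w => [|k IH] w.
  by move=> /eqP; rewrite /dot big_ord0 eq_sym oner_eq0.
rewrite -(row_consP w); move: (w 0 0) (row_behead w) => {w} a w.
rewrite dot_row_cons => ww.
have [a0|a0] := eqVneq a 0.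
  rewrite a0; apply: (volume_preserving_slices (h := fun=> reflection w)).
  - exact: measurable_reflection.
  - move=> x v; rewrite /reflection dot_row_cons mulr0 add0r -scaleNr row_consZ.
    by rewrite row_consD mulr0 addr0 scaleNr.
  - by move=> _; apply: IH; rewrite -ww a0 mulr0 add0r.
pose c := a^-1 *: w.
pose shear s (x : 'rV[R]_k.+1) := x + (s * x 0 0) *: row_cons 0 c.
have shearE s x v : shear s (row_cons x v) = row_cons x (v + (s * x) *: c).
  by rewrite /shear row_consE0 row_consZ row_consD mulr0 addr0.
have shearP s : volume_preserving (shear s).
  apply: (volume_preserving_slices (h := fun x v => v + (s * x) *: c)).
  - apply: measurable_rowD => //; apply: measurable_rowZ.
    by apply: measurable_funM => //; exact: measurable_coord.
  - by move=> x v; rewrite shearE.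
  - by move=> x; exact: volume_preserving_translation.
pose K (x : 'rV[R]_k.+1) :=
  row_cons (- (2 * a * dot (row_behead x) w) - x 0 0) (row_behead x).
have KP : volume_preserving K.
  apply: (volume_preserving_fibers (l := fun v => - (2 * a * dot v w))).
  - apply: measurable_row_cons; last exact: measurable_row_behead.
    apply: measurable_funB; last exact: measurable_coord.
    apply: measurableT_comp => //; apply: measurable_funM => //.
    by apply: measurable_dot; exact: measurable_row_behead.
  - by move=> x v; rewrite /K row_behead_cons row_consE0.
have -> : reflection (row_cons a w) = shear 1 \o (K \o shear (-1)).
  apply/funext => x; rewrite /= -(row_consP x).
  move: (x 0 0) (row_behead x) => {x} x v.
  rewrite shearE /K row_behead_cons row_consE0 shearE.
  rewrite /reflection dot_row_cons -scaleNr row_consZ row_consD.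
  rewrite /c dotDl !dotZl.
  have w2 : dot w w = 1 - a * a by rewrite -ww addrC addKr.
  congr row_cons; first by rewrite w2; field.
  rewrite !scalerA -addrA -scalerDl w2; congr (_ + _ *: _); field.
  by [].
by do 2 apply: volume_preserving_comp => //.
Qed.

End row_measure_invariance.

(** * Hyperplanes and the unit ball *)

Section hyperplane.
Context {R : realType}.
Notation leb := (@lebesgue_measure R).

Lemma row_measure_indic n (A : set 'rV[R]_n) : measurable A ->
  (row_measure n A = \int[row_measure n]_x (\1_A x)%:E)%E.
Proof. by move=> mA; rewrite integral_indic// setIT. Qed.

Lemma measurable_EFin_indic n (A : set 'rV[R]_n) : measurable A ->
  measurable_fun setT (fun x => (\1_A x : R)%:E).
Proof. by move=> mA; exact/measurable_EFinP/measurable_indic. Qed.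

Lemma indic_comp (T U : Type) (f : T -> U) (A : set U) x :
  \1_A (f x) = \1_(f @^-1` A) x :> R.
Proof. by rewrite !indicE; congr (_ %:R); apply/idP/idP; rewrite !inE. Qed.

Lemma row_measure_sliceS k (A : set 'rV[R]_k.+1) : measurable A ->
  (row_measure k.+1 A =
   \int[leb]_x row_measure k [set v | A (row_cons x v)])%E.
Proof.
move=> mA; rewrite row_measure_indic//.
rewrite (integral_row_measureS (measurable_EFin_indic mA))//.
apply: eq_integral => x _; rewrite row_measure_indic; last first.
  rewrite -[X in measurable X]setTI.
  exact: (measurable_row_cons (f := cst x) (g := id)).
by apply: eq_integral => v _; rewrite indic_comp.
Qed.

Lemma row_measure_sliceS_swap k (A : set 'rV[R]_k.+1) : measurable A ->
  (row_measure k.+1 A =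
   \int[row_measure k]_v leb [set x | A (row_cons x v)])%E.
Proof.
move=> mA; rewrite row_measure_indic//.
rewrite (integral_row_measureS_swap (measurable_EFin_indic mA))//.
apply: eq_integral => v _.
have mS : measurable [set x : measurableTypeR R | A (row_cons x v)].
  rewrite -[X in measurable X]setTI.
  exact: (measurable_row_cons (T := measurableTypeR R) (f := id) (g := cst v)).
by rewrite -[X in leb X]setIT -integral_indic.
Qed.

Lemma measurable_hyperplane n (T : 'rV[R]_n) c :
  measurable [set x | dot x T = c].
Proof.
rewrite -[X in measurable X]setTI.
have mT : measurable_fun setT (fun x : 'rV[R]_n => dot x T).
  exact: measurable_dot.
exact: (mT measurableT _ (measurable_set1 c)).
Qed.

(** By induction: if the normal vector is not along the first axis, the
    slices are affine hyperplanes; otherwise the fibers over [v] are points. *)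
Lemma row_measure_hyperplane n (T : 'rV[R]_n) c : T != 0 ->
  row_measure n [set x | dot x T = c] = 0%E.
Proof.
elim: n T c => [|k IH] T c; first by rewrite [T]thinmx0 eqxx.
rewrite -(row_consP T); move: (T 0 0) (row_behead T) => {T} a w T0.
have [w0|w0] := eqVneq w 0; last first.
  rewrite row_measure_sliceS; last exact: measurable_hyperplane.
  apply: integral0_eq => x _;
    rewrite (_ : [set _ | _] = [set v | dot v w = c - x * a]) ?IH//.
  apply/seteqP; split => v /=; rewrite dot_row_cons.
    by move=> <-; ring.
  by move=> ->; ring.
have a0 : a != 0.
  by apply: contraNneq T0 => ->; rewrite w0 /row_cons raddf0 row_mx0.
rewrite row_measure_sliceS_swap; last exact: measurable_hyperplane.
apply: integral0_eq => v _; rewrite (_ : [set _ | _] = [set c / a]).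
  exact: lebesgue_measure_set1.
apply/seteqP; split => x /=; rewrite dot_row_cons w0 dotC dot0l addr0.
  by move=> <-; rewrite mulfK.
by move=> ->; rewrite divfK.
Qed.

End hyperplane.

Section unit_ball.
Context {R : realType}.
Notation leb := (@lebesgue_measure R).

Definition unit_ball {n} : set 'rV[R]_n := [set x | enorm x <= 1].

Lemma measurable_unit_ball n : measurable (@unit_ball n).
Proof.
rewrite -[X in measurable X]setTI.
rewrite (_ : @unit_ball n = @enorm R n @^-1` `]-oo, 1]).
  exact: measurable_enorm.
by apply/seteqP; split => x /=; rewrite in_itv.
Qed.

Definition cube {n} (r : R) : set 'rV[R]_n := [set x | forall i, `|x 0 i| <= r].

Lemma measurable_cube n r : measurable (@cube n r).
Proof.
rewrite (_ : @cube n r = \bigcap_(i in setT) [set x | `|x 0 i| <= r]);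
  last first.
  by apply/seteqP; split => [x h i _|x h i]; [exact: h|exact: (h i)].
apply: fin_bigcap_measurable => // i _.
have mi : measurable_fun setT (fun x : 'rV[R]_n => `|x 0 i|).
  by apply: measurableT_comp => //; exact: measurable_coord.
have := mi measurableT _ (measurable_itv `]-oo, r]); rewrite setTI.
by congr measurable; apply/seteqP; split => x /=; rewrite in_itv.
Qed.

Lemma row_measure0T : row_measure 0 [set: 'rV[R]_0] = 1%E.
Proof.
rewrite row_measure_indic// -(integral_rVE (measurable_EFin_indic _))//.
by rewrite /= indicE in_setT.
Qed.

Lemma row_measure_cube n r : 0 <= r ->
  row_measure n (@cube n r) = ((2 * r) ^+ n)%:E.
Proof.
move=> r0; elim: n => [|k IH].
  rewrite (_ : @cube 0 r = setT) ?row_measure0T//.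
  by apply/seteqP; split => // x _ [].
rewrite row_measure_sliceS; last exact: measurable_cube.
transitivity (\int[leb]_(x in `[(- r)%R, r]) cst ((2 * r) ^+ k)%:E x)%E.
  rewrite [RHS]integral_mkcond; apply: eq_integral => x _.
  rewrite patchE; case: ifPn => [|];
    rewrite ?inE ?notin_setE/= in_itv/= -ler_norml.
    move=> xr; rewrite -IH; congr (row_measure _ _).
    apply/seteqP; split => v /= h i; first by have := h (lift 0 i);
      rewrite row_consES.
    by case: (unliftP 0 i) => [j|] ->; rewrite ?row_consES ?row_consE0.
  move=> xr; rewrite (_ : [set _ | _] =
    set0) ?measure0// -subset0 => v /= /(_ 0).
  by rewrite row_consE0 => /xr.
transitivity (((2 * r) ^+ k)%:E * leb `[(- r)%R, r])%E.
  by apply: integral_cst; exact: measurable_itv.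
rewrite lebesgue_measure_itv/= lte_fin; case: ltP => [rr|rr].
  by rewrite -EFinB -EFinM; congr (_ %:E); rewrite exprSr; ring.
have -> : r = 0 by lra.
by rewrite mule0 mulr0 exprS mul0r.
Qed.

Lemma coord_le_enorm n (x : 'rV[R]_n) i : `|x 0 i| <= enorm x.
Proof.
rewrite -(@ler_pXn2r _ 2)// ?nnegrE ?enorm_ge0// enorm_sqr real_normK
  ?num_real//.
rewrite /dot (bigD1 i)//= expr2 lerDl.
by apply: sumr_ge0 => j _; rewrite -expr2 sqr_ge0.
Qed.

Lemma row_measure_unit_ball_lty n : (row_measure n unit_ball < +oo)%E.
Proof.
have mB := @measurable_unit_ball n; have mC := @measurable_cube n 1.
apply: (@le_lt_trans _ _ (row_measure n (cube 1))); last first.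
  by rewrite row_measure_cube// ltry.
apply: le_measure; rewrite ?inE// => x /= x1 i.
exact: le_trans (coord_le_enorm _ _) x1.
Qed.

Lemma row_measure_unit_ball_gt0 n : (0 < row_measure n unit_ball)%E.
Proof.
have mB := @measurable_unit_ball n.
(* [n * r ^+ 2 <= 1] puts the cube inside the ball, also for [n = 0] *)
pose r : R := n.+1%:R^-1; have mC := @measurable_cube n r.
have r0 : 0 < r by rewrite invr_gt0.
apply: (@lt_le_trans _ _ (row_measure n (cube r))).
  by rewrite row_measure_cube ?ltW// lte_fin exprn_gt0// mulr_gt0.
apply: le_measure; rewrite ?inE// => x /= xr; rewrite /unit_ball/=.
rewrite -(@ler_pXn2r _ 2)// ?nnegrE ?enorm_ge0// enorm_sqr expr1n.
have rn : r * n%:R <= 1 by rewrite mulrC ler_pdivrMr// mul1r ler_nat.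
apply: (@le_trans _ _ (\sum_(i < n) r)).
  apply: ler_sum => i _; rewrite -expr2 -real_normK ?num_real//.
  apply: (@le_trans _ _ (r ^+ 2)); first by rewrite ler_pXn2r// ?nnegrE ?ltW.
  by rewrite expr2 ler_piMl // ?(ltW r0) // /r invf_le1// ler1n.
by rewrite sumr_const card_ord -mulr_natr.
Qed.

(** The ball lies between two cubes, whose volumes are finite and positive. *)
Lemma ball_volume_gt0 n : 0 < fine (row_measure n unit_ball).
Proof. by rewrite fine_gt0// row_measure_unit_ball_gt0
  row_measure_unit_ball_lty. Qed.

End unit_ball.

(** * Averages over the unit ball *)

Section ball_mean.
Context {R : realType} {n : nat}.
Notation mu := (@row_measure R n).
Notation B := (@unit_ball R n).
Implicit Types h g : 'rV[R]_n -> R.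

(** The mean over the ball, rather than over the sphere, is the form in
    which [sphere_avg] is given; the two agree on functions of the
    direction. *)
Definition ball_mean h : R := (\int[mu]_(x in B) h x) / fine (mu B).

(** A class of functions stable under the operations below, on which the
    mean is additive without further hypotheses. *)
Definition tame h : Prop :=
  measurable_fun setT h /\ exists M, forall x, `|h x| <= M.

Lemma tame_integrable h : tame h -> mu.-integrable B (EFin \o h).
Proof.
move=> [mh [M hM]]; apply: measurable_bounded_integrable.
- exact: measurable_unit_ball.
- exact: row_measure_unit_ball_lty.
- exact: measurable_funTS.
- exists M; split; first exact: num_real.
  by move=> N MN x _; exact: le_trans (hM x) (ltW MN).
Qed.

Lemma tame_cst c : tame (cst c).
Proof. by split; [exact: measurable_cst|exists `|c|]. Qed.

Lemma tameD h g : tame h -> tame g -> tame (fun x => h x + g x).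
Proof.
move=> [mh [M hM]] [mg [N gN]]; split; first exact: measurable_funD.
by exists (M + N) => x; exact: le_trans (ler_normD _ _) (lerD _ _).
Qed.

Lemma tameZ c h : tame h -> tame (fun x => c * h x).
Proof.
move=> [mh [M hM]]; split; first exact: measurable_funM.
by exists (`|c| * M) => x; rewrite normrM ler_wpM2l.
Qed.

Lemma tameB h g : tame h -> tame g -> tame (fun x => h x - g x).
Proof.
move=> th tg; rewrite (_ : (fun x => _) = (fun x => h x + -1 * g x)).
  by apply: tameD => //; exact: tameZ.
by apply/funext => x; rewrite mulN1r.
Qed.

Lemma tame_norm h : tame h -> tame (fun x => `|h x|).
Proof.
move=> [mh [M hM]]; split; first exact: measurableT_comp.
by exists M => x; rewrite normr_id.
Qed.

Lemma tame_sum I (r : seq I) (P : pred I) (F : I -> 'rV[R]_n -> R) :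
  (forall i, P i -> tame (F i)) -> tame (fun x => \sum_(i <- r | P i) F i x).
Proof.
move=> tF; elim: r => [|i r IH].
  rewrite (_ : (fun x => _) = cst 0); first exact: tame_cst.
  by apply/funext => x; rewrite big_nil.
case Pi : (P i); under eq_fun do rewrite big_cons Pi; last by [].
by apply: tameD => //; exact: tF.
Qed.

Lemma tame_sg (T : 'rV[R]_n) : tame (fun x => Num.sg (dot x T)).
Proof.
split; last by exists 1 => x; rewrite normr_sg; case: (_ != _).
have -> : (fun x : 'rV[R]_n => Num.sg (dot x T)) =
    (fun x => \1_`]0, +oo[%classic (dot x T) - \1_`]-oo, 0[%classic (dot x T)).
  apply/funext => x; rewrite !indicE.
  case: (ltrgt0P (dot x T)) => [h|h|->].
  - by rewrite gtr0_sg// mem_set ?memNset ?subr0//= in_itv/= ?andbT// ltNge ltW.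
  - by rewrite ltr0_sg// memNset ?mem_set ?sub0r//= in_itv/= ?andbT// ltNge ltW.
  - by rewrite sgr0 !memNset ?subrr//= in_itv/= ltxx.
have mT : measurable_fun setT (fun x : 'rV[R]_n => dot x T).
  exact: measurable_dot.
have mI (A : set R) : measurable A ->
    measurable_fun setT (fun x : 'rV[R]_n => \1_A (dot x T) : R).
  move=> mA; have mA1 : measurable_fun setT (\1_A : R -> R).
    exact: measurable_indic.
  exact: measurableT_comp mA1 mT.
by apply: measurable_funB; exact: mI.
Qed.

Lemma ball_meanD h g : tame h -> tame g ->
  ball_mean (fun x => h x + g x) = ball_mean h + ball_mean g.
Proof.
move=> th tg; rewrite /ball_mean -mulrDl; congr (_ / _).
by rewrite RintegralD//; [exact: measurable_unit_ball|exact: tame_integrable..].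
Qed.

Lemma ball_meanZ c h : tame h -> ball_mean (fun x => c * h x) = c * ball_mean h.
Proof.
move=> th; rewrite /ball_mean mulrA; congr (_ / _).
by rewrite RintegralZl//; [exact: measurable_unit_ball|exact: tame_integrable].
Qed.

Lemma ball_mean_cst c : ball_mean (cst c) = c.
Proof.
rewrite /ball_mean Rintegral_cst; last exact: measurable_unit_ball.
by rewrite mulfK// gt_eqF// ball_volume_gt0.
Qed.

Lemma ball_mean_le h g : tame h -> tame g -> (forall x, h x <= g x) ->
  ball_mean h <= ball_mean g.
Proof.
move=> th tg hg; rewrite /ball_mean ler_wpM2r ?invr_ge0 ?(ltW (ball_volume_gt0
  _))//.
by apply: (le_Rintegral _ (tame_integrable th) (tame_integrable tg)) => //;
  exact: measurable_unit_ball.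
Qed.

Lemma ball_mean_sum I (r : seq I) (P : pred I) (F : I -> 'rV[R]_n -> R) :
  (forall i, P i -> tame (F i)) ->
  ball_mean (fun x => \sum_(i <- r | P i) F i x) =
  \sum_(i <- r | P i) ball_mean (F i).
Proof.
move=> tF; elim: r => [|i r IH].
  rewrite big_nil -[RHS](ball_mean_cst 0); congr ball_mean.
  by apply/funext => x; rewrite big_nil.
rewrite big_cons; case Pi : (P i); under eq_fun do rewrite big_cons Pi;
  last by [].
by rewrite ball_meanD ?IH//; [exact: tF|exact: tame_sum].
Qed.

Lemma dot_reflection (w x y : 'rV[R]_n) :
  dot (reflection w x) y = dot x (reflection w y).
Proof. by rewrite /reflection dotBl dotBr dotZl dotZr (dotC y w) ; ring. Qed.

Lemma reflectionK (w : 'rV[R]_n) : dot w w = 1 -> involutive (reflection w).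
Proof.
move=> ww x; rewrite /reflection dotBl dotZl ww -addrA -opprD -scalerDl.
by rewrite (_ : 2 * dot x w + _ = 0) ?scale0r ?subr0//; ring.
Qed.

Lemma enorm_reflection (w x : 'rV[R]_n) : dot w w = 1 ->
  enorm (reflection w x) = enorm x.
Proof. by move=> ww; rewrite /enorm dot_reflection reflectionK. Qed.

(** Adding a bound for [|h|] makes the integrand nonnegative, as is needed
    for the change of variable. *)
Lemma ball_mean_reflection (w : 'rV[R]_n) h : dot w w = 1 -> tame h ->
  ball_mean (h \o reflection w) = ball_mean h.
Proof.
move=> ww th; have [mw iw] := volume_preserving_reflection ww.
have [mh [M hM]] := th.
have thw : tame (h \o reflection w).
  by split; [exact: (measurableT_comp mh mw)|exists M => x; exact: hM].
(* the integrands below are nonnegative *)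
suff : ball_mean (fun x => (h \o reflection w) x + M) =
  ball_mean (fun x => h x + M).
  by rewrite !ball_meanD// ?ball_mean_cst; [exact: addIr|exact: tame_cst..].
rewrite /ball_mean /Rintegral; congr (fine _ / _).
have mB := @measurable_unit_ball R n.
pose F x := ((h x + M) * \1_B x)%:E.
have mF : measurable_fun setT F.
  apply/measurable_EFinP; apply: measurable_funM; last exact: measurable_indic.
  exact: measurable_funD.
have F0 x : (0 <= F x)%E.
  rewrite lee_fin mulr_ge0// -lerBlDr sub0r.
  by have := hM x; rewrite ler_norml => /andP[].
rewrite integral_mkcond [RHS]integral_mkcond.
transitivity (\int[mu]_x F (reflection w x))%E.
  apply: eq_integral => x _; rewrite /F patchE.
  rewrite indicE (_ : (_ \in B) = (x \in B)); first last.
    by apply/idP/idP; rewrite !inE /unit_ball/= enorm_reflection.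
  by case: (x \in B); rewrite ?mulr1 ?mulr0.
rewrite iw//; apply: eq_integral => x _; rewrite /F patchE indicE.
by case: (x \in B); rewrite ?mulr1 ?mulr0.
Qed.

Lemma sphere_avgE h : tame h -> (forall x, 0 <= h x) ->
  (forall c x, 0 < c -> h (c *: x) = h x) ->
  sphere_avg h = ball_mean h.
Proof.
move=> [mh [M hM]] h0 hZ.
have mB := @measurable_unit_ball R n.
rewrite /sphere_avg -/B /ball_mean /Rintegral.
have hE x : h ((enorm x)^-1 *: x) = h x.
  have [->|x0] := eqVneq x 0; first by rewrite scaler0.
  by rewrite hZ// invr_gt0 enorm_gt0.
under [X in integral_rV X]eq_fun do rewrite hE.
rewrite integral_rVE//; last 2 first.
- by apply/measurable_EFinP; apply: measurable_funM => //;
  exact: measurable_indic.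
- by move=> x; rewrite lee_fin mulr_ge0.
rewrite integral_rVE//; last exact: measurable_EFin_indic.
rewrite integral_indic// setIT integral_mkcond; congr (fine _ / _).
by apply: eq_integral => x _; rewrite patchE indicE; case: (x \in B);
  rewrite ?mulr1 ?mulr0.
Qed.

(** Monotone convergence, in the form needed for the lower bound: the
    functions [D k] reach the value [K] almost everywhere, at ranks that
    depend on the point. *)
Lemma ball_mean_monotone_limit (D : nat -> 'rV[R]_n -> R) (K C : R) :
  (forall k, tame (D k)) -> (forall k x, 0 <= D k x) ->
  (forall x, {homo D^~ x : i j / (i <= j)%N >-> i <= j}) ->
  {ae mu, forall x, exists k, K <= D k x} ->
  0 <= K -> (forall k, ball_mean (D k) <= C) -> K <= C.
Proof.
move=> tD D0 ndD DK K0 DC.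
have mB := @measurable_unit_ball R n.
have vB := @ball_volume_gt0 R n.
have vBE : (fine (mu B))%:E = mu B.
  by rewrite fineK// ge0_fin_numE// row_measure_unit_ball_lty.
have mD k : measurable_fun B (fun x => (D k x)%:E).
  by apply/measurable_EFinP/measurable_funTS; exact: (tD k).1.
have Dge0 k x : B x -> (0 <= (D k x)%:E)%E by rewrite lee_fin.
have ndDE x : B x -> {homo (fun k => (D k x)%:E) : i j / (i <= j)%N >-> (i <=
  j)%E}.
  by move=> _ i j ij; rewrite lee_fin ndD.
have := monotone_convergence mu mB mD Dge0 ndDE.
move=> mc.
have : (K%:E * mu B <= C%:E * mu B)%E.
  apply: (@le_trans _ _ (\int[mu]_(x in B) limn (fun k => (D k x)%:E))%E).
    rewrite -(integral_cst mu mB).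
    apply: ae_ge0_le_integral => //.
    - by move=> x Bx; apply: lime_ge;
      [exact: ereal_nondecreasing_is_cvgn (ndDE x Bx)|apply: nearW => k;
        exact: Dge0].
    - apply: (@emeasurable_fun_cvg _ _ _ _ (fun k x => (D k x)%:E)) => // x Bx.
      exact: ereal_nondecreasing_is_cvgn (ndDE x Bx).
    - apply: filterS DK => x [k Kk] Bx.
      apply: lime_ge; first exact: ereal_nondecreasing_is_cvgn (ndDE x Bx).
      exists k => // j /= kj; rewrite lee_fin (le_trans Kk)// ndD//.
  rewrite mc; apply: lime_le.
    apply: ereal_nondecreasing_is_cvgn => i j ij; apply: ge0_le_integral => //.
    - by move=> x Bx; rewrite lee_fin.
    - by move=> x Bx; exact: ndDE.
  apply: nearW => k; have := DC k.
  rewrite /ball_mean /Rintegral ler_pdivrMr// -lee_fin EFinM vBE fineK//.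
  exact: integrable_fin_num (tame_integrable (tD k)).
by rewrite -vBE -!EFinM lee_fin ler_pM2r.
Qed.

End ball_mean.

(** * The sign distance between directions *)

Section sign_distance.
Context {R : realType} {n : nat}.
Implicit Types u v w T : 'rV[R]_n.

(** The reflection of [T] changes the sign of [<x, T>]. *)
Lemma ball_mean_sg T : dot T T = 1 ->
  ball_mean (fun x => Num.sg (dot x T)) = 0.
Proof.
move=> TT; have tT := tame_sg T.
have : ball_mean ((fun x => Num.sg (dot x T)) \o reflection T) =
       ball_mean (fun x => -1 * Num.sg (dot x T)).
  congr ball_mean; apply/funext => x; rewrite /= dot_reflection.
  rewrite /reflection TT mulr1 (_ : T - 2 *: T = - T) ?dotNr ?sgrN ?mulN1r//.
  by rewrite scaler_nat mulr2n opprD addrA subrr sub0r.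
rewrite ball_mean_reflection// ball_meanZ// => h; lra.
Qed.

Lemma ae_dot_neq0 T : T != 0 ->
  {ae @row_measure R n, forall x, dot x T != 0}.
Proof.
move=> T0; exists [set x | dot x T = 0]; split.
- exact: measurable_hyperplane.
- exact: row_measure_hyperplane.
- by move=> x /= /negP; rewrite negbK => /eqP.
Qed.

Lemma ball_mean_abs_sg T : T != 0 ->
  ball_mean (fun x => `|Num.sg (dot x T)|) = 1.
Proof.
move=> T0; have tT : tame (fun x => `|Num.sg (dot x T)|).
  exact/tame_norm/tame_sg.
apply/eqP; rewrite eq_le; apply/andP; split.
  rewrite -[leRHS](@ball_mean_cst R n 1); apply: ball_mean_le => //.
    exact: tame_cst.
  by move=> x; rewrite /cst normr_sg; case: (_ != _).
apply: (@ball_mean_monotone_limit _ _ (fun=> fun x => `|Num.sg (dot x T)|)) =>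
  //.
  by move=> x i j _.
apply: filterS (ae_dot_neq0 T0) => x xT; exists 0%N.
by rewrite normr_sg xT.
Qed.

(** The probability that a random hyperplane through the origin separates
    [u] from [v]; for unit vectors this is their angle divided by [pi]. *)
Definition sign_dist u v : R :=
  ball_mean (fun x => `|Num.sg (dot x u) - Num.sg (dot x v)|) / 2.

Lemma tame_sign_diff u v :
  tame (fun x => `|Num.sg (dot x u) - Num.sg (dot x v)|).
Proof. by apply/tame_norm/tameB; exact: tame_sg. Qed.

Lemma sign_dist_triangle u v w :
  sign_dist u w <= sign_dist u v + sign_dist v w.
Proof.
rewrite /sign_dist -mulrDl ler_pM2r ?invr_gt0//.
rewrite -ball_meanD; try exact: tame_sign_diff.
apply: ball_mean_le => [| |x]; first exact: tame_sign_diff.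
  by apply: tameD; exact: tame_sign_diff.
exact: ler_distD.
Qed.

Lemma sign_distC u v : sign_dist u v = sign_dist v u.
Proof.
by congr (ball_mean _ / _); apply/funext => x; rewrite distrC.
Qed.

Lemma sign_distxx u : sign_dist u u = 0.
Proof.
transitivity (ball_mean (cst 0 : 'rV[R]_n -> R) / 2); last first.
  by rewrite ball_mean_cst mul0r.
by congr (ball_mean _ / _); apply/funext => x; rewrite subrr normr0.
Qed.

Lemma sign_dist_le1 u v : sign_dist u v <= 1.
Proof.
rewrite /sign_dist ler_pdivrMr// mul1r -[leRHS](@ball_mean_cst R n 2).
apply: ball_mean_le => [| |x]; first exact: tame_sign_diff.
  exact: tame_cst.
rewrite /cst (le_trans (ler_normB _ _))// !normr_sg.
by case: (_ != _); case: (_ != _) => /=; lra.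
Qed.

Lemma sign_dist_ge0 u v : 0 <= sign_dist u v.
Proof.
rewrite divr_ge0// -[leLHS](@ball_mean_cst R n 0).
apply: ball_mean_le => [| |x];
  [exact: tame_cst|exact: tame_sign_diff|exact: normr_ge0].
Qed.

Lemma sign_distNN u v : sign_dist (- u) (- v) = sign_dist u v.
Proof.
congr (ball_mean _ / _); apply/funext => x.
by rewrite !dotNr !sgrN -opprD normrN.
Qed.

Lemma sign_dist_reflection w u v : dot w w = 1 ->
  sign_dist (reflection w u) (reflection w v) = sign_dist u v.
Proof.
move=> ww; congr (_ / _); rewrite -(ball_mean_reflection ww (tame_sign_diff u
  v)).
by congr ball_mean; apply/funext => x; rewrite /= !dot_reflection.
Qed.

Lemma sgr_homo (x y : R) : x <= y -> Num.sg x <= Num.sg y.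
Proof. by move=> xy; case: (sgrP x) => ?; case: (sgrP y) => ?; lra. Qed.

(** The sign function is monotone, and [a * x + b * y] lies between [(a + b)
    * x] and [(a + b) * y]. *)
Lemma sgr_between (x y a b : R) : 0 <= a -> 0 <= b -> 0 < a + b ->
  `|Num.sg x - Num.sg y| =
  `|Num.sg x - Num.sg (a * x + b * y)| + `|Num.sg (a * x + b * y) - Num.sg y|.
Proof.
(* the claim is symmetric under the exchange of [(x, a)] and [(y, b)] *)
wlog xy : x y a b / x <= y.
  move=> H a0 b0 ab; case: (leP x y) => [xy|/ltW yx]; first exact: H.
  rewrite distrC (H y x b a)//; last by rewrite addrC.
  by rewrite (addrC (b * y)) [LHS]addrC; congr (_ + _); exact: distrC.
move=> a0 b0 ab.
have xz : Num.sg x <= Num.sg (a * x + b * y).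
  by rewrite -(mul1r (Num.sg x)) -(gtr0_sg ab) -sgrM; apply: sgr_homo; nra.
have zy : Num.sg (a * x + b * y) <= Num.sg y.
  by rewrite -(mul1r (Num.sg y)) -(gtr0_sg ab) -sgrM; apply: sgr_homo; nra.
by rewrite !ler0_norm ?subr_le0 ?(le_trans xz)//; ring.
Qed.

Lemma sign_dist_cone u v w (a b : R) : 0 <= a -> 0 <= b -> 0 < a + b ->
  v = a *: u + b *: w -> sign_dist u w = sign_dist u v + sign_dist v w.
Proof.
move=> a0 b0 ab ->; rewrite /sign_dist -mulrDl; congr (_ / _).
rewrite -ball_meanD; try exact: tame_sign_diff.
congr ball_mean; apply/funext => x.
by rewrite dotDr !dotZr; exact: sgr_between.
Qed.

Section great_circle.
Variables u w : 'rV[R]_n.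
Hypotheses (uu : dot u u = 1) (ww : dot w w = 1) (uw : dot u w = 0).

Definition great_circle (t : R) := cos t *: u + sin t *: w.

Lemma dot_great_circle s t :
  dot (great_circle s) (great_circle t) = cos (s - t).
Proof.
rewrite /great_circle dotDl !dotDr !dotZl !dotZr uu ww uw (dotC w u) uw cosB.
ring.
Qed.

Lemma great_circle0 : great_circle 0 = u.
Proof. by rewrite /great_circle cos0 sin0 scale1r scale0r addr0. Qed.

Lemma reflection_great_circle s t :
  reflection (great_circle s) (great_circle t) = - great_circle (s *+ 2 - t).
Proof.
rewrite /reflection dot_great_circle.
have {1 2}-> : t = s - (s - t) by ring.
have -> : s *+ 2 - t = s + (s - t) by rewrite mulr2n; ring.
set d := s - t; rewrite /great_circle (_ : s - d - s = - d); last by ring.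
by apply/rowP => i; rewrite !mxE cosN cosB sinB cosD sinD; ring.
Qed.

(** The reflection with axis at angle [t / 2] exchanges, up to sign, the
    angles [r] and [t - r]. *)
Lemma sign_dist_great_circle s t :
  sign_dist (great_circle s) (great_circle t) =
  sign_dist u (great_circle (t - s)).
Proof.
have cc : dot (great_circle (t / 2)) (great_circle (t / 2)) = 1.
  by rewrite dot_great_circle subrr cos0.
rewrite -(sign_dist_reflection _ _ cc) !reflection_great_circle sign_distNN.
have -> : (t / 2) *+ 2 = t by rewrite mulr2n; field.
by rewrite subrr great_circle0 sign_distC.
Qed.

(** For angles of sum less than [pi] the intermediate vector lies in the
    cone of the extreme ones. *)
Lemma sign_dist_great_circleD s t : 0 < s -> 0 < t -> s + t < pi ->
  sign_dist u (great_circle (s + t)) =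
  sign_dist u (great_circle s) + sign_dist u (great_circle t).
Proof.
move=> s0 t0 stpi.
have pos (r : R) : 0 < r -> r < pi -> 0 < sin r by move=> *;
  apply: sin_gt0_pi; apply/andP.
have sst := pos _ (addr_gt0 s0 t0) stpi.
have ss : 0 < sin s by apply: pos => //; lra.
have st : 0 < sin t by apply: pos => //; lra.
have -> : sign_dist u (great_circle t) =
  sign_dist (great_circle s) (great_circle (s + t)).
  by rewrite sign_dist_great_circle; congr (sign_dist _ (great_circle _)); ring.
apply: (@sign_dist_cone _ _ _ (sin t / sin (s + t)) (sin s / sin (s + t))).
- by rewrite divr_ge0// ltW.
- by rewrite divr_ge0// ltW.
- by rewrite addr_gt0// divr_gt0.
apply: (scalerI (lt0r_neq0 sst)).
rewrite [RHS]scalerDr !scalerA ![sin (s + t) * (_ / _)]mulrC !divfK ?gt_eqF//.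
rewrite /great_circle !scalerDr !scalerA addrA -scalerDl.
congr (_ *: _ + _ *: _); last by rewrite mulrC.
have h : cos s * cos s = 1 - sin s * sin s by rewrite -!expr2 cos2sin2.
rewrite sinD cosD.
transitivity (sin t * (cos s * cos s) + sin s * cos s * cos t); first ring.
by rewrite h; ring.
Qed.

Lemma sign_dist_great_circleMn k t : 0 < t -> t *+ k.+1 < pi ->
  sign_dist u (great_circle (t *+ k.+1)) =
  sign_dist u (great_circle t) *+ k.+1.
Proof.
move=> t0; elim: k => [|k IH] tk; first by rewrite !mulr1n.
rewrite mulrSr [RHS]mulrSr sign_dist_great_circleD//; last by rewrite -mulrSr.
  by rewrite IH// (le_lt_trans _ tk)// ler_pMn2l.
by rewrite pmulrn_lgt0.
Qed.

(** With [N] the largest integer such that [N t < pi], additivity gives [N *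
    sign_dist <= 1], while [pi - t <= N t]. *)
Lemma sign_dist_great_circle_le t : 0 < t -> t < pi ->
  sign_dist u (great_circle t) <= t / (pi - t).
Proof.
move=> t0 tpi.
have [N [N0 Npi piN]] : exists N, [/\ (0 < N)%N, t *+ N < pi & pi <= t *+ N.+1].
  have exN : exists N, pi <= t *+ N.
    exists (Num.bound (pi / t)); rewrite -mulr_natl -ler_pdivrMr//.
    by apply/ltW/archi_boundP; rewrite divr_ge0// ?pi_ge0// ltW.
  case: (ex_minnP exN) => -[|[|N]]; first by rewrite mulr0n leNgt pi_gt0.
    by rewrite mulr1n leNgt tpi.
  move=> piN Nmin; exists N.+1; split => //.
  by rewrite ltNge; apply/negP => /Nmin; rewrite ltnn.
case: N N0 Npi piN => // N _ Npi piN.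
have := sign_dist_le1 u (great_circle (t *+ N.+1)).
rewrite sign_dist_great_circleMn// -mulr_natl => h.
rewrite ler_pdivlMr ?subr_gt0//.
have p0 := sign_dist_ge0 u (great_circle t).
move: piN; rewrite -mulr_natr -natr1 => piN.
apply: (@le_trans _ _ (sign_dist u (great_circle t) * (t * N.+1%:R))).
  by rewrite ler_wpM2l//; lra.
by rewrite mulrCA -[leRHS]mulr1 ler_pM2l// mulrC.
Qed.

End great_circle.

End sign_distance.

(** * Sign distance and chord length of nearby directions *)

Section sign_dist_local.
Context {R : realType}.

Lemma sin_ge_near0 (e : R) : 0 < e ->
  exists2 d, 0 < d & forall x, 0 < x -> x < d -> (1 - e) * x <= sin x.
Proof.
move=> e0.
have := @is_derive_sin R 0.
rewrite cos0 => -[ds d1].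
have : h^-1 *: (sin (h *: 1 + 0) - sin 0) @[h --> (0:R)^'] --> 'D_1 (@sin R) 0.
  exact: ds.
rewrite d1 =>  /cvgrPdist_lt /(_ _ e0) [d /= d0 H].
exists d => // x x0 xd.
have := H x; rewrite /ball_/= sub0r normrN gtr0_norm// => /(_ xd (lt0r_neq0
  x0)).
rewrite addr0 sin0 subr0 /GRing.scale/= mulr1.
move=> /(le_lt_trans (ler_norm _)); rewrite ltrBlDr -ltrBlDl => /ltW.
by rewrite mulrC ler_pdivlMr.
Qed.

Lemma dot_unit_bounds n (u v : 'rV[R]_n) : dot u u = 1 -> dot v v = 1 ->
  -1 <= dot u v <= 1.
Proof.
move=> uu vv; have eu : enorm u = 1 by rewrite /enorm uu sqrtr1.
have ev : enorm v = 1 by rewrite /enorm vv sqrtr1.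
have := dot_le_enorm u v; rewrite eu ev mulr1 => ->; rewrite andbT.
have := dot_le_enorm (- u) v; rewrite dotNl /enorm dotNl dotNr uu vv opprK.
by rewrite sqrtr1 mulr1; lra.
Qed.

Lemma enorm_sub_unit n (u v : 'rV[R]_n) : dot u u = 1 -> dot v v = 1 ->
  enorm (u - v) ^+ 2 = 2 - 2 * dot u v.
Proof.
by move=> uu vv; rewrite enorm_sqr dotBl !dotBr uu vv (dotC v u); ring.
Qed.

(** Orthonormalization puts [v] on a great circle through [u]. *)
Lemma sign_dist_le_acos n (u v : 'rV[R]_n) : dot u u = 1 -> dot v v = 1 ->
  -1 < dot u v < 1 ->
  sign_dist u v <= acos (dot u v) / (pi - acos (dot u v)).
Proof.
move=> uu vv /andP[]; set c := dot u v => c1 c2.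
have cb : -1 <= c <= 1 by exact: dot_unit_bounds.
have s0 : 0 < 1 - c ^+ 2 by rewrite expr2; nra.
pose s := Num.sqrt (1 - c ^+ 2).
have sp : 0 < s by rewrite sqrtr_gt0.
have ss : s * s = 1 - c * c by rewrite -expr2 sqr_sqrtr ?ltW// expr2.
pose w := s^-1 *: (v - c *: u).
have uw : dot u w = 0 by rewrite dotZr dotBr dotZr uu -/c mulr1 subrr mulr0.
have w1 : dot w w = 1.
  rewrite dotZl dotZr dotBl !dotBr !dotZl !dotZr uu vv (dotC v u) -/c.
  rewrite (_ : _ - _ = s * s); last by rewrite ss; ring.
  by field; rewrite gt_eqF.
have -> : v = great_circle u w (acos c).
  rewrite /great_circle acosK ?in_itv/= ?cb// sin_acos// -/s /w scalerA.
  by rewrite divff ?gt_eqF// scale1r addrC subrK.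
apply: sign_dist_great_circle_le => //.
  by apply: acos_gt0; rewrite c2 ltW.
by apply: acos_ltpi; rewrite c1 ltW.
Qed.

(** With [al] the angle of [u] and [v], the bound [al / (pi - al)] and the
    chord [2 * sin (al / 2)] are equivalent, up to the factor [pi], as [al]
    tends to 0. *)
Lemma sign_dist_local n (e : R) : 0 < e ->
  exists2 d, 0 < d & forall u v : 'rV[R]_n, dot u u = 1 -> dot v v = 1 ->
    enorm (u - v) < d -> pi * sign_dist u v <= (1 + e) * enorm (u - v).
Proof.
move=> e0.
(* one factor [1 - h] pays for replacing the sine by its argument, another
   one for replacing [pi - al] by [pi] *)
pose h := e / (2 * (1 + e)).
have e1 : 0 < 1 + e by lra.
have h0 : 0 < h by rewrite divr_gt0// mulr_gt0.
have hE : (1 + e) * (1 - 2 * h) = 1 by rewrite /h; field; rewrite gt_eqF.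
have [d1 d10 sinle] := sin_ge_near0 h0.
pose a := Num.min 2^-1 (Num.min (2 * d1) (pi * h)).
have pi0 := pi_gt0 R; have pi2 := pi_ge2 R.
have a0 : 0 < a.
  by rewrite !lt_min; apply/and3P; split; [lra|exact: mulr_gt0..].
have a1 : a <= 2^-1 by rewrite ge_min lexx.
have a2 : a <= 2 * d1 by rewrite !ge_min lexx orbT.
have a3 : a <= pi * h by rewrite !ge_min lexx !orbT.
have cosa : cos a < 1.
  by rewrite -cos0 ltr_cos// in_itv/= ?lexx ?ltW//=; lra.
(* the length of a chord that subtends the angle [a] *)
exists (Num.sqrt (2 - 2 * cos a)) => [|u v uu vv uvd].
  by rewrite sqrtr_gt0; lra.
have /andP[] := dot_unit_bounds uu vv.
have := enorm_sub_unit uu vv; set c := dot u v => uv2 c1 c2.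
have [c1'|c1'] := eqVneq c 1.
  have : enorm (u - v) ^+ 2 = 0 by rewrite uv2 c1'; ring.
  move/eqP; rewrite sqrf_eq0 enorm_eq0 subr_eq0 => /eqP ->.
  by rewrite sign_distxx mulr0 mulr_ge0 ?enorm_ge0// ltW.
have cc : -1 < c < 1.
  rewrite [c < 1]lt_neqAle c1' c2 andbT.
  have : enorm (u - v) ^+ 2 < 2 - 2 * cos a.
    have p : 0 <= 2 - 2 * cos a by lra.
    by rewrite -[ltRHS]sqr_sqrtr// ltr_pXn2r// nnegrE ?enorm_ge0// sqrtr_ge0.
  have : 0 < cos a by apply: cos_gt0_pihalf; apply/andP; split; lra.
  rewrite uv2; lra.
have := sign_dist_le_acos uu vv cc; rewrite -/c.
set al := acos c.
have cb : -1 <= c <= 1 by rewrite c1.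
have al0 : 0 < al by apply: acos_gt0; rewrite c1 lt_neqAle c1' c2.
have alpi : al < pi by apply: acos_ltpi; case/andP: cc => -> _.
have calE : cos al = c by rewrite acosK// in_itv.
have enE : enorm (u - v) = 2 * sin (al / 2).
  apply/eqP; rewrite -(@eqrXn2 _ 2)// ?enorm_ge0//; last first.
    by rewrite mulr_ge0// sin_ge0_pi//; apply/andP; split; lra.
  rewrite uv2 -calE {1}(_ : al = (al / 2) *+ 2); last by rewrite mulr2n; field.
  by rewrite cos_mulr2n cos2sin2; apply/eqP; rewrite mulr2n; ring.
have ala : al < a.
  have : cos a < cos al.
    rewrite calE; have p : 0 <= 2 - 2 * cos a by lra.
    have : enorm (u - v) ^+ 2 < 2 - 2 * cos a.
      by rewrite -[ltRHS]sqr_sqrtr// ltr_pXn2r// nnegrE ?enorm_ge0// sqrtr_ge0.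
    by rewrite uv2; lra.
  by rewrite ltr_cos// in_itv/=; apply/andP; split; lra.
move=> sd.
have sd2 : pi * sign_dist u v <= pi * (al / (pi - al)) by rewrite ler_pM2l.
apply: (le_trans sd2); rewrite enE.
have sal : (1 - h) * (al / 2) <= sin (al / 2) by apply: sinle; lra.
have pal : 0 < pi - al by lra.
rewrite mulrA ler_pdivrMr//.
apply: (@le_trans _ _ ((1 + e) * (2 * ((1 - h) * (al / 2))) * (pi - al)));
  last first.
  by rewrite ler_pM2r// ler_pM2l// ler_pM2l.
have h1 : 2 * h < 1 by nra.
have : (1 - h) * (pi - al) >= pi * (1 - 2 * h).
  nra.
move=> k.
have : al * (1 + e) * (pi * (1 - 2 * h)) <= al * (1 + e) * ((1 - h) * (pi -
  al)).
  by rewrite ler_pM2l// mulr_gt0.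
rewrite [X in X <= _](_ : _ = al * pi * ((1 + e) * (1 - 2 * h))); last ring.
rewrite hE; lra.
Qed.

End sign_dist_local.

(** * The tangent indicatrix of a regular arc *)

Section sign_dist_path.
Context {R : realType} {n : nat}.
Variables (T : R -> 'rV[R]_n) (L : R -> R) (M : R).
Hypothesis T1 : forall t, 0 <= t <= 1 -> dot (T t) (T t) = 1.
Hypothesis TL : forall s t, 0 <= s -> s <= t -> t <= 1 ->
  enorm (T s - T t) <= L t - L s.
Hypothesis LM : forall s t, 0 <= s -> s <= t -> t <= 1 -> L t - L s <= M * (t
  - s).

(** The Lipschitz constant [M] makes the steps of a fine subdivision short,
    so that [sign_dist_local] applies to each of them; the triangle
    inequality sums the estimates. *)
Lemma sign_dist_path a b : 0 <= a -> a <= b -> b <= 1 ->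
  pi * sign_dist (T a) (T b) <= L b - L a.
Proof.
move=> a0 ab b1.
have Lab : 0 <= L b - L a by exact: le_trans (enorm_ge0 _) (TL a0 ab b1).
apply/ler_addgt0Pr => e0 e0p.
(* the summand 1 covers constant paths *)
pose e := e0 / (1 + (L b - L a)).
have e1 : 0 < e by rewrite divr_gt0//; lra.
suff : pi * sign_dist (T a) (T b) <= (1 + e) * (L b - L a).
  move=> /le_trans; apply; rewrite mulrDl mul1r lerD2l /e mulrAC.
  by rewrite ler_pdivrMr ?ler_pM2l//; lra.
have [d d0 Hd] := @sign_dist_local R n e e1.
have [N HN] : exists N : nat, M * (b - a) / d < N.+1%:R.
  exists (Num.bound (`|M * (b - a) / d|)).
  rewrite (le_lt_trans (ler_norm _))// (lt_trans (archi_boundP _))//.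
  by rewrite ltr_nat.
pose t (i : nat) := a + (b - a) * (i%:R / N.+1%:R).
have tS i : t i.+1 - t i = (b - a) / N.+1%:R by rewrite /t -natr1; field.
have tiS i : t i <= t i.+1 by rewrite -subr_ge0 tS divr_ge0// subr_ge0.
have tge i : a <= t i by rewrite lerDl mulr_ge0 ?subr_ge0// divr_ge0.
have tle i : (i <= N.+1)%N -> t i <= b.
  move=> iN; rewrite -lerBrDl -[leRHS]mulr1 ler_wpM2l ?subr_ge0//.
  by rewrite ler_pdivrMr// mul1r ler_nat.
have H i : (i <= N.+1)%N ->
    pi * sign_dist (T a) (T (t i)) <= (1 + e) * (L (t i) - L a).
  elim: i => [_|i IH iN].
    by rewrite /t mulr0n mul0r mulr0 addr0 sign_distxx subrr !mulr0.
  have t0 := le_trans a0 (tge i).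
  have t1 : t i.+1 <= 1 by exact: le_trans (tle _ iN) b1.
  have st : pi * sign_dist (T (t i)) (T (t i.+1)) <= (1 + e) * (L (t i.+1) - L
    (t i)).
    apply: (@le_trans _ _ ((1 + e) * enorm (T (t i) - T (t i.+1)))); last first.
      by rewrite ler_pM2l; [exact: TL|lra].
    apply: Hd; [by apply: T1; rewrite t0 (le_trans (tiS i))| |].
      by apply: T1; rewrite t1 (le_trans t0).
    apply: le_lt_trans (TL t0 (tiS i) t1) _.
    apply: le_lt_trans (LM t0 (tiS i) t1) _.
    by rewrite tS mulrA ltr_pdivrMr// -ltr_pdivrMl// mulrC.
  have := IH (ltnW iN); have := sign_dist_triangle (T a) (T (t i)) (T (t i.+1)).
  rewrite -(ler_pM2l (pi_gt0 R)) mulrDr; nra.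
have := H N.+1 (leqnn _).
by rewrite /t divff// mulr1 addrCA subrr addr0.
Qed.

End sign_dist_path.

Section row_calculus.
Context {R : realType} {n : nat}.
Implicit Types (f : R -> 'rV[R]_n) (t : R) (v : 'rV[R]_n).

Lemma is_derive_coord f t i : derivable f t 1 ->
  is_derive t 1 (fun s => f s 0 i) (derive1 f t 0 i).
Proof.
move=> df; have /derivable_mxP/(_ 0 i) dfi := df.
apply: DeriveDef => //.
by rewrite derive1E derive_mx// mxE.
Qed.

Lemma is_derive_row f t v :
  (forall i, is_derive t 1 (fun s => f s 0 i) (v 0 i)) ->
  derivable f t 1 /\ derive1 f t = v.
Proof.
move=> fv; have df : derivable f t 1.
  by apply/derivable_mxP => i j; rewrite ord1; exact: ex_derive.
split => //; apply/rowP => i.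
by rewrite derive1E derive_mx// mxE derive_val.
Qed.

Lemma is_derive_dot f t w : derivable f t 1 ->
  is_derive t 1 (fun s => dot (f s) w) (dot (derive1 f t) w).
Proof.
move=> df; rewrite /dot.
have : is_derive t 1 (\sum_(i < n) (fun s => f s 0 i * w 0 i))
          (\sum_(i < n) derive1 f t 0 i * w 0 i).
  apply: is_derive_sum => i.
  have := is_derive_coord i df.
  move=> ?; apply: is_derive_eq; rewrite scaler0 add0r.
  by rewrite /GRing.scale/= mulrC.
by congr is_derive; apply/funext => s; rewrite fct_sumE.
Qed.

End row_calculus.

Section tangent.
Context {R : realType} {n : nat}.
Variable g : R -> 'rV[R]_n.
Hypothesis gC2 : C2 g.
Hypothesis g_regular : forall t, 0 <= t <= 1 -> derive1 g t != 0.
Notation g' := (derive1 g).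
Notation g'' := (derive1 (derive1 g)).
Notation T := (unit_tangent g).
Notation mu := (@lebesgue_measure R).

Lemma enormZ c (u : 'rV[R]_n) : enorm (c *: u) = `|c| * enorm u.
Proof.
by rewrite /enorm dotZl dotZr mulrA -expr2 sqrtrM ?sqr_ge0// sqrtr_sqr.
Qed.

Lemma dot_subZ c (u v : 'rV[R]_n) : dot (u - c *: v) (u - c *: v) =
  dot u u - c * dot u v - c * (dot u v - c * dot v v).
Proof. by rewrite dotBl !dotBr !dotZl !dotZr (dotC v u); ring. Qed.

Lemma continuous_dot (f h : R -> 'rV[R]_n) t :
  {for t, continuous f} -> {for t, continuous h} ->
  {for t, continuous (fun s => dot (f s) (h s))}.
Proof.
move=> cf ch; rewrite /prop_for /continuous_at /dot.
apply: cvg_big => [|i _]; first exact: add_continuous.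
apply: continuousM.
  exact: (continuous_comp cf (@coord_continuous _ _ _ 0 i _)).
exact: (continuous_comp ch (@coord_continuous _ _ _ 0 i _)).
Qed.

Lemma continuous_velocity t : {for t, continuous g'}.
Proof.
have [_ d2 _] := gC2.
by apply/differentiable_continuous/derivable1_diffP; exact: d2.
Qed.

Lemma dot_tangent t : 0 <= t <= 1 -> dot (T t) (T t) = 1.
Proof. by move=> t01; exact/dot_normalized/g_regular. Qed.

(** The derivative of [g' / |g'|]: the component of [g''] orthogonal to
    [g'], divided by [|g'|]. *)
Definition tangent_derivative t : 'rV[R]_n :=
  (enorm (g' t))^-1 *:
  (g'' t - (dot (g'' t) (g' t) / dot (g' t) (g' t)) *: g' t).

Lemma is_derive_tangent t : 0 <= t <= 1 ->
  derivable T t 1 /\ derive1 T t = tangent_derivative t.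
Proof.
move=> t01; have v0 := g_regular t01; have [_ d2 _] := gC2.
apply: is_derive_row => i.
have q0 : 0 < dot (g' t) (g' t) by rewrite -enorm_sqr exprn_gt0// enorm_gt0.
have dq : is_derive t 1 (fun s => dot (g' s) (g' s)) (2 * dot (g'' t) (g' t)).
  rewrite /dot.
  have : is_derive t 1 (\sum_(j < n) (fun s => g' s 0 j * g' s 0 j))
      (\sum_(j < n) 2 * (g'' t 0 j * g' t 0 j)).
    apply: is_derive_sum => j.
    have ? := is_derive_coord j (d2 t).
    apply: is_derive_eq; rewrite /GRing.scale/=; ring.
  rewrite mulr_sumr; congr is_derive; apply/funext => s; by rewrite fct_sumE.
have dN : is_derive t 1 (fun s => enorm (g' s))
    (dot (g'' t) (g' t) / enorm (g' t)).
  have := @is_derive1_comp _ Num.sqrt (fun s => dot (g' s) (g' s)) t _ _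
     (is_derive1_sqrt q0) dq.
  rewrite -[Num.sqrt (dot (g' t) (g' t))]/(enorm (g' t)) => h.
  apply: is_derive_eq; field; by rewrite enorm_eq0.
have e0 : enorm (g' t) != 0 by rewrite enorm_eq0.
have dV := @is_deriveV _ (fun s => enorm (g' s)) t _ 1 e0 dN.
have dc := is_derive_coord i (d2 t).
have dM := is_deriveM dV dc.
have -> : (fun s => T s 0 i) =
  (fun s => (enorm (g' s))^-1) * (fun s => g' s 0 i).
  by apply/funext => s; rewrite /unit_tangent mxE.
apply: is_derive_eq; rewrite !mxE -enorm_sqr /GRing.scale/=; field.
by [].
Qed.

Definition speed_of_turning t : R := enorm (tangent_derivative t).

(** By Pythagoras, [speed_of_turning] is a continuous expression in the
    inner products of [g'] and [g'']. *)
Lemma continuous_speed_of_turning t : 0 <= t <= 1 ->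
  {for t, continuous speed_of_turning}.
Proof.
move=> t01; have v0 := g_regular t01; have [_ _ c2] := gC2.
have -> : speed_of_turning = (fun t => Num.sqrt
    ((dot (g' t) (g' t))^-1 * (dot (g'' t) (g'' t) +
      - (dot (g'' t) (g' t) * dot (g'' t) (g' t) * (dot (g' t) (g' t))^-1)))).
  apply/funext => s; rewrite /speed_of_turning /tangent_derivative enormZ.
  rewrite ger0_norm ?invr_ge0 ?enorm_ge0//.
  rewrite sqrtrM ?invr_ge0 ?dot_ge0// sqrtrV ?dot_ge0//; congr (_ * Num.sqrt _).
  have [->|s0] := eqVneq (g' s) 0.
    by rewrite (dotC _ 0) dot0l scaler0 !subr0 !mul0r oppr0 addr0.
  have key (A B V : R) : V != 0 ->
      A - B / V * B - B / V * (B - B / V * V) = A - B * B * V^-1.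
    by move=> V0; field.
  have V0 : dot (g' s) (g' s) != 0 by rewrite dot_eq0.
  rewrite -(key _ _ _ V0); exact: dot_subZ.
have cv := @continuous_velocity t; have ca := c2 t.
pose V s := dot (g' s) (g' s); pose B s := dot (g'' s) (g' s).
pose A s := dot (g'' s) (g'' s).
have cV : {for t, continuous V} by exact: (continuous_dot cv cv).
have cB : {for t, continuous B} by exact: (continuous_dot ca cv).
have cA : {for t, continuous A} by exact: (continuous_dot ca ca).
have V0 : V t != 0 by rewrite /V dot_eq0.
change {for t, continuous (fun s =>
  Num.sqrt ((V s)^-1 * (A s + - (B s * B s * (V s)^-1))))}.
move: V B A V0 cV cB cA => V B A V0 cV cB cA.
have cW : {for t, continuous (fun s => (V s)^-1)} by exact: (@continuousV _ _
  V).
apply: (@continuous_comp _ _ _ _ Num.sqrt); last exact: sqrt_continuous.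
apply: (continuousM cW); apply: (continuousD cA); apply: continuousN.
exact: (continuousM (continuousM cB cB) cW).
Qed.

Lemma arc_curvature_turning :
  arc_curvature g = \int[mu]_(t in `[0, 1]) speed_of_turning t.
Proof.
apply: eq_Rintegral => t; rewrite inE/= in_itv/= => t01.
rewrite /curvature_vector (is_derive_tangent t01).2 enormZ.
rewrite ger0_norm ?invr_ge0 ?enorm_ge0// mulrAC mulVf ?mul1r//.
by rewrite enorm_eq0 g_regular.
Qed.

(** The length of the tangent indicatrix up to time [t]. *)
Definition turning (t : R) : R := \int[mu]_(s in `[0, t]) speed_of_turning s.

Lemma within_continuous_01 (f : R -> R) :
  (forall t, 0 <= t <= 1 -> {for t, continuous f}) ->
  {within `[0, 1], continuous f}.
Proof.
move=> cf; apply: continuous_in_subspaceT => t.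
by rewrite inE/= in_itv/=; exact: cf.
Qed.

Lemma integrable_speed_of_turning :
  mu.-integrable `[0, 1] (EFin \o speed_of_turning).
Proof.
apply: continuous_compact_integrable; first exact: segment_compact.
exact/within_continuous_01/continuous_speed_of_turning.
Qed.

Lemma derive_turning t : 0 < t < 1 ->
  derivable turning t 1 /\ derive1 turning t = speed_of_turning t.
Proof.
move=> /andP[t0 t1].
apply: (continuous_FTC1_closed t1 integrable_speed_of_turning t0).
by apply: continuous_speed_of_turning; rewrite !ltW.
Qed.

Lemma continuous_turning : {within `[0, 1], continuous turning}.
Proof.
exact: (parameterized_integral_continuous ler01 integrable_speed_of_turning).
Qed.

(** A comparison principle: the derivative of [turning] is known only in the
    interior of the interval, and [c * turning - f] is nondecreasing. *)
Lemma turning_increments (c : R) (f : R -> R) :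
  (forall t, 0 <= t <= 1 -> derivable f t 1) ->
  (forall t, 0 < t < 1 -> derive1 f t <= c * speed_of_turning t) ->
  forall s t, 0 <= s -> s <= t -> t <= 1 ->
    f t - f s <= c * (turning t - turning s).
Proof.
move=> df ff s t s0 st t1.
suff : c * turning s - f s <= c * turning t - f t by rewrite mulrBr; lra.
apply: (@ger0_derive1_ndecr _ (fun t => c * turning t - f t) 0 1) => //.
- move=> x; rewrite in_itv/= => x01; apply: derivableB.
    by apply: derivableM => //; exact: (derive_turning x01).1.
  by apply: df; case/andP: x01 => *; rewrite !ltW.
- move=> x; rewrite in_itv/= => x01.
  have [dx dxE] := derive_turning x01.
  have dfx : derivable f x 1 by apply: df; case/andP: x01 => *; rewrite !ltW.
  have dt : is_derive x 1 turning (speed_of_turning x).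
    exact: (DeriveDef dx (etrans (esym (derive1E _ _)) dxE)).
  have dB := is_deriveB (is_deriveZ c dt) (derivableP dfx).
  rewrite derive1E (@derive_val _ _ _ _ _ _ _ dB) subr_ge0 -derive1E.
  exact: ff.
- move=> x; apply: cvgB.
    by apply: cvgM; [exact: cvg_cst|exact: continuous_turning].
  apply: within_continuous_01 => {}x x01.
  exact/differentiable_continuous/derivable1_diffP/df.
Qed.

End tangent.

Section sign_dist_arc.
Context {R : realType} {n : nat}.
Variable g : R -> 'rV[R]_n.
Hypothesis gC2 : C2 g.
Hypothesis g_regular : forall t, 0 <= t <= 1 -> derive1 g t != 0.
Notation T := (unit_tangent g).

Lemma turning_ndecr s t : 0 <= s -> s <= t -> t <= 1 ->
  0 <= turning g t - turning g s.
Proof.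
move=> s0 st t1.
have := @turning_increments _ _ _ gC2 g_regular 1 (cst 0) _ _ s t s0 st t1.
rewrite /cst subrr mul1r; apply => [x _|x _]; first exact: derivable_cst.
by rewrite derive1_cst mul1r enorm_ge0.
Qed.

(** For [w = T t - T s], apply [turning_increments] to [r |-> <T r, w>],
    whose increment is [|w|^2] and whose slope is at most [|w|] times the
    speed of turning. *)
Lemma tangent_le_turning s t : 0 <= s -> s <= t -> t <= 1 ->
  enorm (T s - T t) <= turning g t - turning g s.
Proof.
move=> s0 st t1; rewrite -opprB -scaleN1r enormZ normrN1 mul1r.
have [->|w0] := eqVneq (T t - T s) 0.
  by rewrite /enorm dot0l sqrtr0 turning_ndecr.
set w := T t - T s in w0 *.
have ew : 0 < enorm w by rewrite enorm_gt0.
have := @turning_increments _ _ _ gC2 g_regular (enorm w)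
  (fun r => dot (T r) w) _ _ s t s0 st t1.
rewrite -dotBl -/w -enorm_sqr expr2 ler_pM2l//; apply => [x x01|x x01].
  by have [dT _] := is_derive_tangent gC2 g_regular x01;
    have [] := is_derive_dot w dT.
have [|dT TE] := is_derive_tangent gC2 g_regular (t := x).
  by case/andP: x01 => *; rewrite !ltW.
have ? := is_derive_dot w dT.
by rewrite derive1E derive_val TE mulrC; exact: dot_le_enorm.
Qed.

Lemma turning_lipschitz : exists M, forall s t, 0 <= s -> s <= t -> t <= 1 ->
  turning g t - turning g s <= M * (t - s).
Proof.
have [c _ cM] := EVT_max ler01
  (within_continuous_01 (continuous_speed_of_turning gC2 g_regular)).
exists (speed_of_turning g c) => s t s0 st t1.
have := @turning_increments _ _ _ gC2 g_regular (-1)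
  (fun r => - speed_of_turning g c * r) _ _ s t s0 st t1.
rewrite mulN1r -mulrBr mulNr lerN2; apply => [x x01|x x01].
  exact: derivableM.
rewrite derive1E.
have -> : 'D_1 (fun r => - speed_of_turning g c * r) x = - speed_of_turning g c.
  have -> : (fun r => - speed_of_turning g c * r) =
    (- speed_of_turning g c) *: id by [].
  by rewrite deriveZ// derive_id /GRing.scale/= mulr1.
rewrite mulN1r lerN2; apply: cM; rewrite in_itv/=.
by case/andP: x01 => *; rewrite !ltW.
Qed.

Lemma sign_dist_arc a b : 0 <= a -> a <= b -> b <= 1 ->
  pi * sign_dist (T a) (T b) <= turning g b - turning g a.
Proof.
have [M LM] := turning_lipschitz.
apply: (sign_dist_path _ _ LM) => [t|s t]; first exact: dot_tangent.
exact: tangent_le_turning.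
Qed.

Lemma turning0 : turning g 0 = 0.
Proof. by rewrite /turning set_itv1 Rintegral_set1. Qed.

Lemma turning1 : turning g 1 = arc_curvature g.
Proof. by rewrite arc_curvature_turning. Qed.

Lemma sum_sign_dist_arc N (t : nat -> R) : t 0%N = 0 -> t N = 1 ->
  (forall i, t i <= t i.+1) ->
  pi * (\sum_(i < N) sign_dist (T (t i)) (T (t i.+1))) <= arc_curvature g.
Proof.
move=> t0 tN tS.
have tge i : 0 <= t i by elim: i => [|i IH]; rewrite ?t0//;
  exact: le_trans IH (tS i).
have tle i : (i <= N)%N -> t i <= 1.
  rewrite -tN => /subnK <-; elim: (N - i)%N => [|k IH]//.
  by apply: le_trans IH _; rewrite addSn.
have -> : arc_curvature g = turning g (t N) - turning g (t 0%N).
  by rewrite tN t0 turning1 turning0 subr0.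
rewrite mulr_sumr -(telescope_sumr (fun i => turning g (t i)) (leq0n N))
  big_mkord.
by apply: ler_sum => i _; apply: sign_dist_arc => //; exact: tle.
Qed.

End sign_dist_arc.

(** * Sign changes at dyadic times *)

Section variation.
Context {R : realType}.
Implicit Types (s : nat -> R) (N : nat).

Definition variation N s : R := \sum_(i < N) `|s i - s i.+1|.

Definition has_fall N s : bool :=
  [exists i : 'I_N.+1, exists j : 'I_N.+1,
    [&& (i < j)%N, s i == 1 & s j == -1]].

Lemma variationS N s : variation N.+1 s = variation N s + `|s N - s N.+1|.
Proof. by rewrite /variation big_ord_recr. Qed.

Lemma variation_refine N s s' : (forall i, s i = s' i.*2) ->
  variation N s <= variation N.*2 s'.
Proof.
move=> ss'; elim: N => [|N IH]; first by rewrite /variation !big_ord0.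
rewrite doubleS !variationS -addrA lerD// !ss' doubleS.
exact: ler_distD.
Qed.

Lemma fall_le s i j N : (i <= j)%N -> (j <= N)%N ->
  s i - s j <= \sum_(k < N) Num.max 0 (s k - s k.+1).
Proof.
move=> ij jN; apply: (@le_trans _ _ (\sum_(i <= k < j) Num.max 0 (s k - s
  k.+1))).
  rewrite -opprB -(telescope_sumr s ij) -sumrN; apply: ler_sum => k _.
  by rewrite opprB le_max lexx orbT.
rewrite -(big_mkord xpredT (fun k => Num.max 0 (s k - s k.+1))).
rewrite (big_cat_nat (leq0n i) (leq_trans ij jN))/= (big_cat_nat ij jN)/=.
rewrite addrCA lerDl addr_ge0//; apply: sumr_ge0 => k _; by rewrite le_max lexx.
Qed.

(** The second summand detects a rise; rises and falls contribute separately
    to the variation. *)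
Lemma variation_ge N s :
  2 * (has_fall N s)%:R + 2 * (has_fall N (fun i => - s i))%:R <= variation N s.
Proof.
have fall2 r : 2 * (has_fall N r)%:R <= \sum_(k < N) Num.max 0 (r k - r k.+1).
  case: (boolP (has_fall N r)) => [|_]; last first.
    by rewrite mulr0; apply: sumr_ge0 => k _; rewrite le_max lexx.
  move=> /existsP[i /existsP[j /and3P[ij /eqP ri /eqP rj]]].
  apply: le_trans (fall_le r (ltnW ij) (ltn_ord j : (j <= N)%N)).
  by rewrite ri rj mulr1; lra.
apply: le_trans (lerD (fall2 s) (fall2 _)) _.
rewrite -big_split/=; apply: ler_sum => k _.
rewrite (_ : - s k - - s k.+1 = - (s k - s k.+1)); last by ring.
case: (lerP 0 (s k - s k.+1)) => h.
  by rewrite ger0_norm// (max_l (y := - _)) ?addr0 ?oppr_le0.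
by rewrite ltr0_norm// (max_r (y := - _)) ?add0r// oppr_ge0 ltW.
Qed.

Lemma has_fall_refine N s s' : (forall i, s i = s' i.*2) ->
  has_fall N s -> has_fall N.*2 s'.
Proof.
move=> ss' /existsP[i /existsP[j /and3P[ij si sj]]].
have iN : (i.*2 < N.*2.+1)%N by rewrite ltnS leq_double -ltnS.
have jN : (j.*2 < N.*2.+1)%N by rewrite ltnS leq_double -ltnS.
apply/existsP; exists (Ordinal iN); apply/existsP; exists (Ordinal jN) => /=.
by rewrite ltn_double ij -!ss' si sj.
Qed.

End variation.

Section dyadic.
Context {R : realType}.

Definition dyadic (k i : nat) : R := i%:R / (2 ^ k)%:R.

Lemma dyadic_ge0 k i : 0 <= dyadic k i.
Proof. by rewrite divr_ge0. Qed.

Lemma dyadicS k i : dyadic k i = dyadic k.+1 i.*2.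
Proof.
rewrite /dyadic expnS -mul2n !natrM invfM mulrACA divff ?mul1r//.
Qed.

Lemma dyadic_mono k i : dyadic k i <= dyadic k i.+1.
Proof. by rewrite ler_pM2r ?ler_nat// invr_gt0 ltr0n expn_gt0. Qed.

Lemma dyadic0 k : dyadic k 0 = 0.
Proof. by rewrite /dyadic mul0r. Qed.

Lemma dyadic1 k : dyadic k (2 ^ k) = 1.
Proof. by rewrite /dyadic divff// pnatr_eq0 -lt0n expn_gt0. Qed.

Lemma dyadic_lt k i j : (dyadic k i < dyadic k j) = (i < j)%N.
Proof. by rewrite ltr_pM2r ?ltr_nat// invr_gt0 ltr0n expn_gt0. Qed.

Lemma dyadic_le1 k i : (dyadic k i <= 1) = (i <= 2 ^ k)%N.
Proof. by rewrite -(dyadic1 k) leNgt dyadic_lt -leqNgt. Qed.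

Lemma dyadic_lift k K i : (k <= K)%N -> dyadic k i = dyadic K (i * 2 ^ (K - k)).
Proof.
move=> kK; have -> : K = (K - k + k)%N by rewrite subnK.
rewrite addnK /dyadic expnD !natrM; field.
by rewrite !pnatr_eq0 -!lt0n !expn_gt0.
Qed.

Lemma dyadic_dense (x y : R) : 0 <= x -> x < y ->
  exists k i, x < dyadic k i < y.
Proof.
move=> x0 xy; have d0 : 0 < y - x by rewrite subr_gt0.
(* multiples of [2 ^- k] are closer to each other than [x] and [y] *)
pose k := Num.bound ((y - x)^-1).
have kP : (y - x)^-1 < (2 ^ k)%:R.
  apply: (@lt_trans _ _ k%:R); first by apply: archi_boundP;
    rewrite invr_ge0 ltW.
  by rewrite ltr_nat ltn_expl.
have p0 : 0 < (2 ^ k)%:R :> R by rewrite ltr0n expn_gt0.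
exists k, (Num.truncn (x * (2 ^ k)%:R)).+1.
have xk0 : 0 <= x * (2 ^ k)%:R by rewrite mulr_ge0// ltW.
have /andP[t1 t2] := truncn_itv xk0.
rewrite /dyadic ltr_pdivlMr// t2/= ltr_pdivrMr// -natr1.
move: kP; rewrite -[_^-1]mul1r ltr_pdivrMr//; lra.
Qed.

End dyadic.

Section monotone_points.
Context {R : realType}.
Variable h : R -> R.
Hypothesis dh : forall t, derivable h t 1.
Hypothesis ch : continuous (derive1 h).

Lemma derive1_gt0_near x : 0 < derive1 h x ->
  exists2 d, 0 < d & forall t, `|t - x| < d -> 0 < derive1 h t.
Proof.
move=> hx; have := @ch x => /cvgrPdist_lt /(_ _ hx) [d /= d0 H].
exists d => // t tx; have := H t; rewrite /ball_/= distrC => /(_ tx).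
by move=> /(le_lt_trans (ler_norm _)); lra.
Qed.

Lemma MVT_derive1 x y : x < y ->
  exists2 z, x < z < y & h y - h x = derive1 h z * (y - x).
Proof.
move=> xy; have [z zxy hz] : exists2 z, z \in `]x, y[%R &
    h y - h x = derive1 h z * (y - x).
  apply: MVT => // [z _|]; first by rewrite derive1E; exact: derivableP.
  apply: continuous_subspaceT => z.
  exact/differentiable_continuous/derivable1_diffP/dh.
by exists z; rewrite // -in_itv.
Qed.

Lemma derive1_gt0_incr x : 0 < derive1 h x ->
  exists2 d, 0 < d & (forall t, x < t -> t < x + d -> h x < h t) /\
                     (forall t, t < x -> x - d < t -> h t < h x).
Proof.
move=> /derive1_gt0_near[d d0 H]; exists d => //; split => t xt td.
  have [z /andP[z1 z2] hz] := MVT_derive1 xt.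
  rewrite -subr_gt0 hz mulr_gt0 ?subr_gt0//; apply: H.
  by rewrite ltr_norml; apply/andP; split; lra.
have [z /andP[z1 z2] hz] := MVT_derive1 xt.
rewrite -subr_gt0 hz mulr_gt0 ?subr_gt0//; apply: H.
by rewrite ltr_norml; apply/andP; split; lra.
Qed.

(** By the mean value theorem the derivative is positive somewhere, hence on
    an interval, which contains a dyadic number. *)
Lemma dyadic_increasing x y : 0 <= x -> x < y -> h x < h y ->
  exists k i, x < dyadic k i < y /\ 0 < derive1 h (dyadic k i).
Proof.
move=> x0 xy hxy; have [z /andP[z1 z2] hz] := MVT_derive1 xy.
have hz0 : 0 < derive1 h z.
  by rewrite -(pmulr_lgt0 _ (_ : 0 < y - x)) -?hz subr_gt0.
have [d d0 H] := derive1_gt0_near hz0.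
have zy : z < Num.min y (z + d) by rewrite lt_min z2 ltrDl.
have [k [i /andP[i1 i2]]] := dyadic_dense (le_trans x0 (ltW z1)) zy.
move: i2; rewrite lt_min => /andP[i2 i3].
exists k, i; rewrite i2 (lt_trans z1)//; split=> //.
by apply: H; rewrite ltr_norml; apply/andP; split; lra.
Qed.

End monotone_points.

(** * The highest point of a drawing *)

Section height.
Context {R : realType} {n : nat} {G : graph}.
Variable f : drawing R n G.
Implicit Types (a : edge G) (q : vertex G) (e : 'rV[R]_n).
Notation T a := (unit_tangent (arc f a)).

Definition tangent_sign a e k (i : nat) : R := Num.sg (dot e (T a (dyadic k
  i))).

(** Only dyadic times are considered, so that almost every direction is
    generic: the exceptional directions form a countable union of
    hyperplanes. *)
Definition generic e : Prop :=
  forall a k i, (i <= 2 ^ k)%N -> dot e (T a (dyadic k i)) != 0.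

Definition degree q : nat :=
  (#|[pred a | tail a == q]| + #|[pred a | head a == q]|)%N.

Definition height e a (t : R) : R := dot (arc f a t) e.

Lemma tangent_neq0 a t : 0 <= t <= 1 -> T a t != 0.
Proof.
by move=> t01; rewrite -dot_eq0 (dot_tangent (@arc_regular _ _ _ f a) t01)
  oner_eq0.
Qed.

Lemma ae_generic : {ae @row_measure R n, forall e, generic e}.
Proof.
suff : {ae @row_measure R n, forall e, forall a, forall k i,
    (i <= 2 ^ k)%N -> dot e (T a (dyadic k i)) != 0} by [].
apply: filter_forall => a; apply/ae_foralln => k; apply/ae_foralln => i.
have [ik|ik] := leqP i (2 ^ k); last by apply: aeW.
apply: filterS (ae_dot_neq0 (tangent_neq0 a (_ : 0 <= dyadic k i <= 1))) => //.
by rewrite dyadic_ge0 dyadic_le1.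
Qed.

Lemma is_derive_height e a (t : R) :
  is_derive t 1 (height e a) (dot (derive1 (arc f a) t) e).
Proof.
have [d1 _ _] := arc_C2 f a.
exact: is_derive_dot.
Qed.

Lemma derive1_height e a (t : R) : derive1 (height e a) t =
  dot (derive1 (arc f a) t) e.
Proof. by rewrite derive1E; have ? := is_derive_height e a t;
  rewrite derive_val. Qed.

Lemma derivable_height e a (t : R) : derivable (height e a) t 1.
Proof. by have [] := is_derive_height e a t. Qed.

Lemma continuous_derive1_height e a : continuous (derive1 (height e a)).
Proof.
move=> t; rewrite (_ : derive1 (height e a) =
  fun t => dot (derive1 (arc f a) t) e); last by apply/funext => s;
    rewrite derive1_height.
apply: continuous_dot; last exact: cst_continuous.
exact: continuous_velocity (arc_C2 f a) t.
Qed.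

Lemma sg_tangent e a (t : R) : 0 <= t <= 1 ->
  Num.sg (dot e (T a t)) = Num.sg (derive1 (height e a) t).
Proof.
move=> t01; rewrite derive1_height /unit_tangent dotZr sgrM gtr0_sg ?mul1r
  1?dotC//.
by rewrite invr_gt0 enorm_gt0 arc_regular.
Qed.

Lemma chi_sumE e q : chi_sum f q e =
  - \sum_(a | tail a == q) Num.sg (dot e (T a 0)) +
  \sum_(a | head a == q) Num.sg (dot e (T a 1)).
Proof.
rewrite /chi_sum /chi -sumrN; congr (_ + _); apply: eq_bigr => a _.
by rewrite dotNr sgrN opprK.
Qed.

Lemma height_tail e a : height e a 0 = dot (pos f (tail a)) e.
Proof. by rewrite /height arc_tail. Qed.

Lemma height_head e a : height e a 1 = dot (pos f (head a)) e.
Proof. by rewrite /height arc_head. Qed.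

Lemma heightN e a : height (- e) a = (fun t => - height e a t).
Proof. by apply/funext => t; rewrite /height dotNr. Qed.

Lemma derive1_heightN e a t : derive1 (height (- e) a) t =
  - derive1 (height e a) t.
Proof. by rewrite !derive1_height dotNr. Qed.

(** At a point of maximal height no edge can leave upwards, and by
    genericity none leaves horizontally. *)
Lemma top_vertex e q (M : R) : generic e ->
  (forall a t, 0 <= t <= 1 -> height e a t <= M) -> dot (pos f q) e = M ->
  chi_sum f q e = (degree q)%:R.
Proof.
move=> gen hM qM; rewrite chi_sumE /degree natrD; congr (_ + _).
  rewrite -sumrN -sumr_const; apply: eq_bigr => a /eqP aq.
  have z01 : 0 <= (0 : R) <= 1 by rewrite lexx ler01.
  have := @gen a 0%N 0%N isT; rewrite dyadic0.
  rewrite -sgr_eq0 sg_tangent// sgr_eq0 neq_lt => /orP[h|h].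
    by rewrite ltr0_sg// opprK.
  have [d d0 [H _]] := derive1_gt0_incr (@derivable_height e a)
    (@continuous_derive1_height e a) h.
  pose t := Num.min 1 (d / 2).
  have t0 : 0 < t by rewrite lt_min ltr01 divr_gt0.
  have t1 : t <= 1 by rewrite ge_min lexx.
  have td : t <= d / 2 by rewrite ge_min lexx orbT.
  have : height e a 0 < height e a t by apply: H => //; lra.
  by rewrite height_tail aq qM ltNge hM// t1 ltW.
rewrite -sumr_const; apply: eq_bigr => a /eqP aq.
have z01 : 0 <= (1 : R) <= 1 by rewrite lexx ler01.
have := @gen a 0%N 1%N isT; have := @dyadic1 R 0; rewrite expn0 => ->.
rewrite -sgr_eq0 sg_tangent// sgr_eq0 neq_lt => /orP[h|h]; last exact: gtr0_sg.
have := h; rewrite -oppr_gt0 -derive1_heightN => /(derive1_gt0_incr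
  (@derivable_height (- e) a) (@continuous_derive1_height (- e) a))[d d0 [_ H]].
pose t := Num.max 0 (1 - d / 2).
have t1 : t < 1 by rewrite gt_max ltr01; lra.
have t0 : 0 <= t by rewrite le_max lexx.
have td : 1 - d / 2 <= t by rewrite le_max lexx orbT.
have : height (- e) a t < height (- e) a 1 by apply: H => //; lra.
by rewrite heightN ltrN2 height_head aq qM ltNge hM// t0 ltW.
Qed.

(** The height increases at a dyadic time before [c] and decreases at one
    after [c]; both are dyadic of a common level. *)
Lemma top_arc e a (c M : R) : generic e -> 0 <= c <= 1 ->
  height e a c = M -> height e a 0 < M -> height e a 1 < M ->
  exists k, has_fall (2 ^ k) (tangent_sign a e k).
Proof.
move=> gen /andP[c0 c1] cM h0 h1.
have cp : 0 < c by rewrite lt_neqAle c0 andbT; apply: contraTneq h0 => ->;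
  rewrite cM ltxx.
have cq : c < 1 by rewrite lt_neqAle c1 andbT; apply: contraTneq h1 => <-;
  rewrite cM ltxx.
rewrite -cM in h0 h1.
have [k1 [i1 [/andP[i1l i1r] hi1]]] := dyadic_increasing (@derivable_height e a)
  (@continuous_derive1_height e a) (lexx 0) cp h0.
have h1N : height (- e) a c < height (- e) a 1 by rewrite heightN ltrN2.
have [k2 [i2 [/andP[i2l i2r] hi2]]] := dyadic_increasing (@derivable_height (-
  e) a)
  (@continuous_derive1_height (- e) a) c0 cq h1N.
(* from here on, [i1] and [i2] are indices at the common level [k] *)
pose k := maxn k1 k2; exists k.
have d1 := @dyadic_lift R _ _ i1 (leq_maxl k1 k2 : (k1 <= k)%N).
have d2 := @dyadic_lift R _ _ i2 (leq_maxr k1 k2 : (k2 <= k)%N).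
rewrite -> d1 in *; rewrite -> d2 in *.
move: (i1 * _)%N (i2 * _)%N => {d1 d2} {}i1 {}i2 in i1l i1r hi1 i2l i2r hi2 *.
have i12 : (i1 < i2)%N by rewrite -(@dyadic_lt R k) (lt_trans i1r).
have i2k : (i2 <= 2 ^ k)%N by rewrite -(@dyadic_le1 R) ltW.
have i1k : (i1 < (2 ^ k).+1)%N by rewrite ltnS (leq_trans (ltnW i12)).
apply/existsP; exists (Ordinal i1k).
apply/existsP; exists (Ordinal (i2k : (i2 < (2 ^ k).+1)%N)) => /=.
have t1 : 0 <= @dyadic R k i1 <= 1 by rewrite dyadic_ge0 dyadic_le1.
have t2 : 0 <= @dyadic R k i2 <= 1 by rewrite dyadic_ge0 dyadic_le1.
have s1 : tangent_sign a e k i1 = 1.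
  by rewrite /tangent_sign (sg_tangent _ _ t1) gtr0_sg.
have s2 : tangent_sign a e k i2 = -1.
  rewrite /tangent_sign (sg_tangent _ _ t2) ltr0_sg//.
  by rewrite -oppr_gt0 -derive1_heightN.
by rewrite i12 s1 s2 !eqxx.
Qed.

Lemma top_alternative e (a0 : edge G) : generic e ->
  (exists q, chi_sum f q e = (degree q)%:R) \/
  (exists a k, has_fall (2 ^ k) (tangent_sign a e k)).
Proof.
move=> gen.
have ch a : {within `[0, 1], continuous (height e a)}.
  apply: continuous_subspaceT => t.
  exact/differentiable_continuous/derivable1_diffP/derivable_height.
have cP a : exists c, 0 <= c <= 1 /\
    forall t, 0 <= t <= 1 -> height e a t <= height e a c.
  have [c c01 cm] := EVT_max ler01 (ch a).
  exists c; split; first by move: c01; rewrite in_itv.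
  by move=> t t01; apply: cm; rewrite in_itv.
pose c a := proj1_sig (cid (cP a)).
have [a _ am] := @Order.TotalTheory.arg_maxP _ _ _ a0 xpredT (fun a => height
  e a (c a)) isT.
have c01 b : 0 <= c b <= 1 by rewrite /c; case: cid => x /= [].
have hM b t : 0 <= t <= 1 -> height e b t <= height e a (c a).
  move=> t01; apply: le_trans (am b isT); rewrite /c.
  by case: (cid (cP b)) => x /= [_]; exact.
have z0 : 0 <= (0 : R) <= 1 by rewrite lexx ler01.
have z1 : 0 <= (1 : R) <= 1 by rewrite lexx ler01.
have [h0|h0] := eqVneq (height e a 0) (height e a (c a)).
  left; exists (tail a); apply: (@top_vertex _ _ (height e a (c a))) => //.
  by rewrite -height_tail.
have [h1|h1] := eqVneq (height e a 1) (height e a (c a)).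
  left; exists (head a); apply: (@top_vertex _ _ (height e a (c a))) => //.
  by rewrite -height_head.
right; exists a; apply: (@top_arc _ _ (c a) (height e a (c a))) => //.
  by rewrite lt_neqAle h0 hM.
by rewrite lt_neqAle h1 hM.
Qed.

End height.

(** * A lower bound from the parities of the degrees *)

Section lower_bound.
Context {R : realType} {n : nat} {G : graph}.
Variable f : drawing R n G.
Implicit Types (a : edge G) (q : vertex G) (e : 'rV[R]_n).
Notation T a := (unit_tangent (arc f a)).

Lemma tame_chi_sum q : tame (chi_sum f q).
Proof.
rewrite (_ : chi_sum f q = fun e =>
  \sum_(a | tail a == q) -1 * Num.sg (dot e (T a 0)) +
  \sum_(a | head a == q) Num.sg (dot e (T a 1))).
  apply: tameD; apply: tame_sum => a _; last exact: tame_sg.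
  exact/tameZ/tame_sg.
apply/funext => e; rewrite chi_sumE -sumrN; congr (_ + _).
by apply: eq_bigr => a _; rewrite mulN1r.
Qed.

Lemma ball_mean_chi_sum q : ball_mean (chi_sum f q) = 0.
Proof.
have sg0 a (t : R) : 0 <= t <= 1 -> ball_mean (fun e => Num.sg (dot e (T a
  t))) = 0.
  by move=> t01; apply/ball_mean_sg/dot_tangent => // s; exact: arc_regular.
rewrite (_ : chi_sum f q = fun e =>
  \sum_(a | tail a == q) -1 * Num.sg (dot e (T a 0)) +
  \sum_(a | head a == q) Num.sg (dot e (T a 1))); last first.
  apply/funext => e; rewrite chi_sumE -sumrN; congr (_ + _).
  by apply: eq_bigr => a _; rewrite mulN1r.
rewrite ball_meanD; last 2 first.
- by apply: tame_sum => a _; exact/tameZ/tame_sg.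
- by apply: tame_sum => a _; exact: tame_sg.
rewrite !ball_mean_sum; last 2 first.
- by move=> a _; exact: tame_sg.
- by move=> a _; exact/tameZ/tame_sg.
rewrite !big1 ?addr0// => a _; first by rewrite sg0// lexx ler01.
by rewrite ball_meanZ ?sg0 ?mulr0 ?lexx ?ler01//; exact: tame_sg.
Qed.

Lemma max0_half (x : R) : Num.max 0 x = 2^-1 * `|x| + 2^-1 * x.
Proof. by case: (lerP 0 x) => h; [rewrite ger0_norm//|rewrite ltr0_norm//];
  lra. Qed.

(** [max 0 x] is half of [|x| + x], and [chi_sum] has mean 0. *)
Lemma ntcE q : ntc f q = pi / 2 * ball_mean (fun e => `|chi_sum f q e|).
Proof.
have tc := tame_chi_sum q.
have hE : (fun e => Num.max 0 (chi_sum f q e)) =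
    (fun e => 2^-1 * `|chi_sum f q e| + 2^-1 * chi_sum f q e).
  by apply/funext => e; exact: max0_half.
have th : tame (fun e => Num.max 0 (chi_sum f q e)).
  by rewrite hE; apply: tameD; apply: tameZ => //; exact: tame_norm.
rewrite /ntc sphere_avgE//; first last.
- move=> c e c0; congr (Num.max _ _); rewrite !chi_sumE; congr (- _ + _);
    by apply: eq_bigr => a _; rewrite dotZl sgrM gtr0_sg// mul1r.
- by move=> e; rewrite le_max lexx.
rewrite hE ball_meanD; try by apply: tameZ => //; exact: tame_norm.
rewrite !ball_meanZ//; last exact: tame_norm.
by rewrite ball_mean_chi_sum mulr0 addr0 mulrA.
Qed.

(** Each change between rising and falling of the height along an arc, if
    seen at the dyadic times of level [k], counts 2 in the second sum. *)
Definition sign_variation k e : R :=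
  \sum_q `|chi_sum f q e| + \sum_a variation (2 ^ k) (tangent_sign f a e k).

Lemma tame_variation a k :
  tame (fun e => variation (2 ^ k) (tangent_sign f a e k)).
Proof. by apply: tame_sum => i _; exact: tame_sign_diff. Qed.

Lemma tame_sign_variation k : tame (sign_variation k).
Proof.
apply: tameD; apply: tame_sum => x _; last exact: tame_variation.
exact/tame_norm/tame_chi_sum.
Qed.

Lemma ball_mean_variation a k :
  pi / 2 * ball_mean (fun e => variation (2 ^ k) (tangent_sign f a e k)) <=
  arc_curvature (arc f a).
Proof.
rewrite ball_mean_sum; last by move=> i _; exact: tame_sign_diff.
have := sum_sign_dist_arc (arc_C2 f a) (@arc_regular _ _ _ f a)
  (dyadic0 k) (dyadic1 k) (dyadic_mono k).
by rewrite /sign_dist -mulr_suml mulrA mulrAC.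
Qed.

Lemma ball_mean_sign_variation k :
  pi / 2 * ball_mean (sign_variation k) <= drawing_NTC f.
Proof.
rewrite ball_meanD; last 2 first.
- by apply: tame_sum => q _; exact/tame_norm/tame_chi_sum.
- by apply: tame_sum => a _; exact: tame_variation.
rewrite !ball_mean_sum; last 2 first.
- by move=> q _; exact/tame_norm/tame_chi_sum.
- by move=> a _; exact: tame_variation.
rewrite mulrDr !mulr_sumr lerD//; apply: ler_sum => x _.
  by rewrite ntcE.
exact: ball_mean_variation.
Qed.

Lemma tangent_signS a e k i :
  tangent_sign f a e k i = tangent_sign f a e k.+1 i.*2.
Proof. by rewrite /tangent_sign -dyadicS. Qed.

Lemma sign_variation_ndecr e :
  {homo sign_variation^~ e : j k / (j <= k)%N >-> j <= k}.
Proof.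
apply: (homo_leq (fun x => lexx x) (fun y x z => @le_trans _ _ y x z)) => k.
rewrite lerD2l; apply: ler_sum => a _; rewrite expnS mul2n.
by apply: variation_refine => i; exact: tangent_signS.
Qed.

Lemma has_fall_ndecr a e j k : (j <= k)%N ->
  has_fall (2 ^ j) (tangent_sign f a e j) ->
  has_fall (2 ^ k) (tangent_sign f a e k).
Proof.
move=> /subnK <-; elim: (k - j)%N => [//|d IH] h.
rewrite addSn expnS mul2n; apply: has_fall_refine (IH h) => i.
exact: tangent_signS.
Qed.

Lemma chi_sumN q e : chi_sum f q (- e) = - chi_sum f q e.
Proof.
have chiN (T : 'rV[R]_n) : chi T (- e) = - chi T e.
  by rewrite /chi dotNl sgrN.
rewrite /chi_sum opprD; congr (_ + _);
  by rewrite -sumrN; apply: eq_bigr => a _; exact: chiN.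
Qed.

Lemma tangent_signN a e k i :
  tangent_sign f a (- e) k i = - tangent_sign f a e k i.
Proof. by rewrite /tangent_sign dotNl sgrN. Qed.

Lemma genericN e : generic f e -> generic f (- e).
Proof. by move=> gen a k i ik; rewrite dotNl oppr_eq0 gen. Qed.

Lemma sum_signs (I : finType) (P : pred I) (s : I -> R) :
  (forall i, P i -> s i = 1 \/ s i = -1) ->
  exists m : nat, \sum_(i | P i) s i = #|P|%:R - 2 * m%:R.
Proof.
move=> sP; exists #|[pred i | P i && (s i == -1)]|.
rewrite -!sum1_card !natr_sum big_mkcondr/= mulr_sumr -sumrB.
apply: eq_bigr => i /sP[|] ->; last by rewrite eqxx; lra.
rewrite (_ : (1 == -1 :> R) = false) ?mulr0 ?subr0//.
by apply/negbTE/eqP => h; lra.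
Qed.

Lemma chi_sum_parity q e : generic f e ->
  exists m : nat, chi_sum f q e = (degree q)%:R - 2 * m%:R.
Proof.
move=> gen; rewrite chi_sumE -sumrN.
have sgP (x : R) : x != 0 -> Num.sg x = 1 \/ Num.sg x = -1.
  by case: (sgrP x) => //; [left|right].
have g0 a : dot e (T a 0) != 0.
  by have := @gen a 0%N 0%N isT; rewrite dyadic0.
have g1 a : dot e (T a 1) != 0.
  by have := @gen a 0%N 1%N isT; have := @dyadic1 R 0; rewrite expn0 => ->.
have [|m1 ->] := @sum_signs _ [pred a | tail a == q] (fun a => - Num.sg (dot e
  (T a 0))).
  by move=> a _; case: (sgP _ (g0 a)) => ->; [right|left; rewrite opprK].
have [|m2 ->] := @sum_signs _ [pred a | head a == q] (fun a => Num.sg (dot e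
  (T a 1))).
  by move=> a _; exact: sgP.
by exists (m1 + m2)%N; rewrite /degree !natrD; ring.
Qed.

(** [chi_sum] is the degree minus twice an integer; when it is plus or minus
    the degree, a degree at least 2 exceeds its parity by at least 2. *)
Lemma abs_chi_sum_ge q e : generic f e -> (2 <= degree q)%N ->
  (odd (degree q))%:R + (2 * (chi_sum f q e == (degree q)%:R)%:R
    + 2 * (chi_sum f q (- e) == (degree q)%:R)%:R) <= `|chi_sum f q e|.
Proof.
move=> gen d2; have [m] := chi_sum_parity q gen; rewrite chi_sumN.
set x := chi_sum f q e; move: (degree q) d2 => d d2 xE.
have d2R : 2 <= d%:R :> R by rewrite ler_nat.
have odd2 : (odd d)%:R + 2 <= d%:R :> R.
  rewrite -natrD ler_nat; case: d d2 {xE d2R} => [|[|[|d]]]// _.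
  by rewrite addnC; case: (odd _).
have [xd|xd] := eqVneq x d%:R.
  rewrite xd (_ : (- d%:R == d%:R :> R) = false); last first.
    by apply/negbTE/eqP => h; lra.
  by rewrite ger0_norm// mulr0 mulr1; lra.
have [xNd|xNd] := eqVneq (- x) d%:R.
  by rewrite -(normrN x) xNd ger0_norm// mulr0 mulr1; lra.
rewrite !mulr0 !addr0; case: (boolP (odd d)) => [od|_] /=;
  last exact: normr_ge0.
have [md|md] := ltnP (2 * m) d.
  have : (2 * m)%:R + 1 <= d%:R :> R by rewrite natr1 ler_nat.
  by rewrite natrM => h; apply: le_trans (ler_norm _); rewrite xE mulr1n; lra.
have {}md : (d < 2 * m)%N.
  by rewrite ltn_neqAle md andbT; apply: contraTneq od => ->;
    rewrite mul2n odd_double.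
have : d%:R + 1 <= (2 * m)%:R :> R by rewrite natr1 ler_nat.
rewrite natrM => h; rewrite -normrN; apply: le_trans (ler_norm _).
by rewrite xE mulr1n; lra.
Qed.

Definition odd_vertices : nat := #|[pred q : vertex G | odd (degree q)]|.

Lemma sum_indic_ge2 (I J : finType) (P : pred I) (Q : pred J) :
  (exists i, P i) \/ (exists j, Q j) ->
  2 <= \sum_i (2 * (P i)%:R) + \sum_j (2 * (Q j)%:R) :> R.
Proof.
move=> PQ.
have P0 i : 0 <= 2 * (P i)%:R :> R by rewrite mulr_ge0.
have Q0 i : 0 <= 2 * (Q i)%:R :> R by rewrite mulr_ge0.
case: PQ => -[i Hi].
  rewrite (bigD1 i)//= Hi mulr1 -addrA lerDl addr_ge0//; apply: sumr_ge0 => *;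
    [exact: P0|exact: Q0].
rewrite addrC (bigD1 i)//= Hi mulr1 -addrA lerDl addr_ge0//;
  apply: sumr_ge0 => *; [exact: Q0|exact: P0].
Qed.

(** The minimum of the height is the maximum in the direction [- e]. *)
Lemma sign_variation_ge (a0 : edge G) e : (forall q, 2 <= @degree G q)%N ->
  generic f e -> exists k, (odd_vertices)%:R + 4 <= sign_variation k e.
Proof.
move=> deg2 gen; have genN := genericN gen.
have lift e' : (exists q, chi_sum f q e' = (degree q)%:R) \/
    (exists a k, has_fall (2 ^ k) (tangent_sign f a e' k)) ->
  exists k0, forall k, (k0 <= k)%N ->
    2 <= \sum_q (2 * (chi_sum f q e' == (degree q)%:R)%:R) +
         \sum_a (2 * (has_fall (2 ^ k) (tangent_sign f a e' k))%:R) :> R.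
  move=> [[q qE]|[a [k0 ak]]].
    by exists 0%N => k _; apply: sum_indic_ge2; left; exists q; exact/eqP.
  exists k0 => k kk; apply: sum_indic_ge2; right; exists a.
  exact: has_fall_ndecr ak.
have [k1 H1] := lift _ (top_alternative a0 gen).
have [k2 H2] := lift _ (top_alternative a0 genN).
exists (maxn k1 k2); set k := maxn _ _.
have {H1} := H1 k (leq_maxl _ _); have {H2} := H2 k (leq_maxr _ _).
have Ha a : 2 * (has_fall (2 ^ k) (tangent_sign f a e k))%:R +
    2 * (has_fall (2 ^ k) (tangent_sign f a (- e) k))%:R <=
    variation (2 ^ k) (tangent_sign f a e k).
  rewrite (_ : tangent_sign f a (- e) k = fun i => - tangent_sign f a e k i).
    exact: variation_ge.
  by apply/funext => i; exact: tangent_signN.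
have Hq : \sum_q ((odd (degree q))%:R + (2 * (chi_sum f q e == (degree q)%:R)%:R
    + 2 * (chi_sum f q (- e) == (degree q)%:R)%:R)) <= \sum_q `|chi_sum f q e|.
  by apply: ler_sum => q _; exact: abs_chi_sum_ge.
have {}Ha : \sum_a (2 * (has_fall (2 ^ k) (tangent_sign f a e k))%:R +
    2 * (has_fall (2 ^ k) (tangent_sign f a (- e) k))%:R) <=
    \sum_a variation (2 ^ k) (tangent_sign f a e k).
  by apply: ler_sum => a _; exact: Ha.
rewrite /sign_variation; move: Hq Ha; rewrite !big_split/=.
have <- : odd_vertices%:R = \sum_(q : vertex G) (odd (degree q))%:R :> R.
  rewrite /odd_vertices -sum1_card natr_sum big_mkcond/=.
  by apply: eq_bigr => q _; rewrite inE; case: (odd _).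
lra.
Qed.

(** The level at which the pointwise bound holds depends on the direction,
    so one passes to the limit by monotone convergence. *)
Theorem NTC_lower_bound (a0 : edge G) : (forall q, 2 <= @degree G q)%N ->
  pi / 2 * (odd_vertices%:R + 4) <= drawing_NTC f.
Proof.
move=> deg2; have pi0 := pi_gt0 R.
rewrite mulrC -ler_pdivlMr ?divr_gt0//.
apply: (ball_mean_monotone_limit tame_sign_variation _ sign_variation_ndecr).
- by move=> k e; rewrite addr_ge0//; apply: sumr_ge0 => *; rewrite ?sumr_ge0.
- by apply: filterS (ae_generic f) => e; exact: sign_variation_ge.
- by rewrite addr_ge0.
- by move=> k; rewrite ler_pdivlMr ?divr_gt0// mulrC ball_mean_sign_variation.
Qed.

End lower_bound.

(** * Degrees in subdivisions and wheels *)

Section subdivision_degrees.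
Variables (G : graph) (k : edge G -> nat).

Lemma card_sub_tail_inl (q : vertex G) :
  #|[pred b : edge (subdivide k) | tail b == inl q]| =
    #|[pred a | tail a == q]|.
Proof.
pose h (a : edge G) : edge (subdivide k) := existT _ a ord0.
have hI : injective h by move=> a b /(congr1 tag).
rewrite -(fintype.card_image hI); apply: eq_card => -[a i]; rewrite !inE.
apply/eqP/fintype.imageP => [|[b]].
  rewrite /= /sub_tail; case: unliftP => [j _ //|->] [aq]; exists a => //.
  by rewrite inE aq.
by rewrite inE => /eqP <- ->; rewrite /= /sub_tail unlift_none.
Qed.

Lemma card_sub_head_inl (q : vertex G) :
  #|[pred b : edge (subdivide k) | head b == inl q]| =
    #|[pred a | head a == q]|.
Proof.
pose h (a : edge G) : edge (subdivide k) := existT _ a ord_max.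
have hI : injective h by move=> a b /(congr1 tag).
rewrite -(fintype.card_image hI); apply: eq_card => -[a i]; rewrite !inE.
apply/eqP/fintype.imageP => [|[b]].
  rewrite /= /sub_head; case: unliftP => [j _ //|->] [aq]; exists a => //.
  by rewrite inE aq.
by rewrite inE => /eqP <- ->; rewrite /= /sub_head unlift_none.
Qed.

Lemma degree_sub_inl (q : vertex G) :
  @degree (subdivide k) (inl q) = @degree G q.
Proof. by rewrite /degree card_sub_tail_inl card_sub_head_inl. Qed.

Lemma degree_sub_inr_ge2 (x : {a : edge G & 'I_(k a)}) :
  (2 <= @degree (subdivide k) (inr x))%N.
Proof.
case: x => a j; rewrite /degree (leq_add (m1 := 1) (m2 := 1))//.
  apply/card_gt0P; exists (existT _ a (lift ord0 j) : edge (subdivide k)).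
  by rewrite inE /= /sub_tail liftK.
apply/card_gt0P; exists (existT _ a (lift ord_max j) : edge (subdivide k)).
by rewrite inE /= /sub_head liftK.
Qed.

Lemma subdivide_degree_ge2 : (forall q, 2 <= @degree G q)%N ->
  forall q, (2 <= @degree (subdivide k) q)%N.
Proof. by move=> d [q|x]; rewrite ?degree_sub_inl// degree_sub_inr_ge2. Qed.

Lemma odd_vertices_subdivide : (@odd_vertices G <= @odd_vertices (subdivide
  k))%N.
Proof.
pose h (q : vertex G) : vertex (subdivide k) := inl q.
have hI : injective h by move=> p q [].
rewrite /odd_vertices -(fintype.card_image hI);
  apply/subset_leq_card/fintype.subsetP => x.
by move=> /fintype.imageP[q]; rewrite !inE => oq ->; rewrite degree_sub_inl.
Qed.

End subdivision_degrees.

Section wheel_degrees.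
Variable m : nat.
Notation W := (wheel m).

Lemma degree_hub : @degree W None = m.
Proof.
have sI : injective (inl : 'I_m -> edge W) by move=> i j [].
rewrite /degree [X in (_ + X)%N]fintype.eq_card0 ?addn0; last by case.
rewrite -[RHS]card_ord -(fintype.card_image sI); apply: eq_card => a.
rewrite !inE; apply/idP/fintype.imageP => [|[i _ ->]//].
by case: a => // i _; exists i.
Qed.

Lemma degree_rim i : @degree W (Some i) = 3%N.
Proof.
rewrite /degree (@fintype.eq_card1 _ (inr i : edge W)); last first.
  by move=> [j|j]; rewrite !inE /=.
rewrite (@fintype.eq_card _ _ (pred2 (inl i : edge W) (inr (ord_pred i) : edge
  W))).
  by rewrite card2.
move=> [j|j]; rewrite !inE /=; first by rewrite orbF.
by apply/eqP/eqP => [[<-]|[->]]; rewrite ?ordSK ?ord_predK.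
Qed.

Lemma odd_vertices_wheel : (m + odd m <= @odd_vertices W)%N.
Proof.
rewrite /odd_vertices (cardD1 None) addnC leq_add//.
  by rewrite inE degree_hub.
have SI : injective (@Some 'I_m) by move=> i j [].
rewrite -[X in (X <= _)%N]card_ord -(fintype.card_image SI).
apply/subset_leq_card/fintype.subsetP => x /fintype.imageP[i _ ->].
by rewrite !inE degree_rim.
Qed.

Theorem wheel_NTC_lower_bound (R : realType) n (f : pw_mapping R n W) :
  (3 <= m)%N -> pi / 2 * ((m + odd m)%:R + 4) <= NTC f.
Proof.
move=> m3; have e0 : edge W := inl (Ordinal (leq_trans (isT : (0 < 3)%N) m3)).
have deg2 (q : vertex W) : (2 <= degree q)%N.
  by case: q => [i|]; rewrite ?degree_rim// degree_hub ltnW.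
have b0 : edge (subdivide (added f)) := existT _ e0 ord0.
apply: le_trans (NTC_lower_bound (pw_drawing f) b0 (subdivide_degree_ge2 deg2)).
rewrite ler_pM2l ?divr_gt0 ?pi_gt0// lerD2r ler_nat.
exact: leq_trans odd_vertices_wheel (odd_vertices_subdivide _).
Qed.

End wheel_degrees.

(** * Drawings on a line *)

Section linear_drawing.
Context {R : realType} {n : nat} {G : graph}.
Variables (u : 'rV[R]_n) (h : vertex G -> R).
Hypothesis uu : dot u u = 1.
Hypothesis h_edge : forall a : edge G, h (tail a) != h (head a).

Let u0 : u != 0.
Proof. by rewrite -dot_eq0 uu oner_eq0. Qed.

Definition rise (a : edge G) : R := h (head a) - h (tail a).

Lemma rise_neq0 a : rise a != 0.
Proof. by rewrite subr_eq0 eq_sym. Qed.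

Definition segment (a : edge G) (t : R) : 'rV[R]_n := (h (tail a) + t * rise
  a) *: u.

Lemma is_derive_segment a t :
  derivable (segment a) t 1 /\ derive1 (segment a) t = rise a *: u.
Proof.
apply: is_derive_row => i.
rewrite (_ : (fun s => segment a s 0 i) =
    cst (h (tail a) * u 0 i) + (rise a * u 0 i) *: id); last first.
  apply/funext => s; rewrite /segment mxE.
  rewrite -[RHS]/(h (tail a) * u 0 i + rise a * u 0 i * s); ring.
have := is_deriveD (is_derive_cst (h (tail a) * u 0 i) t 1)
  (is_deriveZ (rise a * u 0 i) (is_derive_id t 1)).
by rewrite add0r mxE /GRing.scale/= mulr1.
Qed.

Lemma derive1_segment a : derive1 (segment a) = cst (rise a *: u).
Proof. by apply/funext => t; exact: (is_derive_segment a t).2. Qed.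

Lemma segment_C2 a : C2 (segment a).
Proof.
split; rewrite ?derive1_segment; first by move=> t;
  exact: (is_derive_segment a t).1.
  by move=> t; exact: derivable_cst.
have -> : derive1 (cst (rise a *: u)) = cst (0 : 'rV[R]_n).
  by apply/funext => t; rewrite derive1_cst.
exact: cst_continuous.
Qed.

Lemma segment_regular a t : 0 <= t <= 1 -> derive1 (segment a) t != 0.
Proof. by rewrite derive1_segment scaler_eq0 negb_or rise_neq0 u0. Qed.

Lemma segment_tail a : segment a 0 = h (tail a) *: u.
Proof. by rewrite /segment mul0r addr0. Qed.

Lemma segment_head a : segment a 1 = h (head a) *: u.
Proof. by rewrite /segment mul1r /rise addrC subrK. Qed.

Definition linear_drawing : drawing R n G := {|
  pos := fun q => h q *: u;
  arc := segment;
  arc_C2 := segment_C2;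
  arc_regular := segment_regular;
  arc_tail := segment_tail;
  arc_head := segment_head |}.

(** On a line, [chi_sum] is this number times the sign of the direction:
    edges going down minus edges going up. *)
Definition balance (q : vertex G) : R :=
  \sum_(a | head a == q) Num.sg (rise a) - \sum_(a | tail a == q) Num.sg (rise
    a).

Lemma unit_tangent_segment a : unit_tangent (segment a) =
  cst (Num.sg (rise a) *: u).
Proof.
apply/funext => t; rewrite /unit_tangent derive1_segment enormZ scalerA.
rewrite /enorm uu sqrtr1 mulr1; congr (_ *: _).
by rewrite -[in X in _ * X](mulr_sg_norm (rise a)) mulrCA mulVf ?mulr1//
  normr_eq0 rise_neq0.
Qed.

Lemma chi_sum_linear q e :
  chi_sum linear_drawing q e = balance q * Num.sg (dot e u).
Proof.
rewrite chi_sumE /balance mulrBl addrC !mulr_suml; congr (_ - _);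
  apply: eq_bigr => a _; rewrite /= unit_tangent_segment dotZr sgrM;
    by rewrite sgr_id.
Qed.

Lemma arc_curvature_segment a : arc_curvature (segment a) = 0.
Proof.
rewrite /arc_curvature (@eq_Rintegral _ _ _ _ _ (cst 0)); last first.
  move=> t _; rewrite /curvature_vector unit_tangent_segment derive1_cst.
  by rewrite scaler0 /enorm dot0l sqrtr0 mul0r.
by rewrite Rintegral_cst ?mul0r.
Qed.

Lemma NTC_linear_drawing :
  drawing_NTC linear_drawing = pi / 2 * \sum_q `|balance q|.
Proof.
rewrite /drawing_NTC [X in _ + X]big1 ?addr0; last first.
  by move=> a _; exact: arc_curvature_segment.
rewrite mulr_sumr; apply: eq_bigr => q _; rewrite ntcE; congr (_ * _).
rewrite (_ : (fun e => _) = fun e => `|balance q| * `|Num.sg (dot e u)|).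
  by rewrite ball_meanZ ?ball_mean_abs_sg ?mulr1//; exact/tame_norm/tame_sg.
by apply/funext => e; rewrite chi_sum_linear normrM.
Qed.

End linear_drawing.

Section linear_mapping.
Context {R : realType} {n : nat} {G : graph}.
Variables (u : 'rV[R]_n) (h : vertex G -> R).
Hypothesis uu : dot u u = 1.
Hypothesis h_edge : forall a : edge G, h (tail a) != h (head a).

Let G0 : graph := @subdivide G (fun=> 0%N).

Let h0 (q : vertex G0) : R := match q with inl q => h q | inr _ => 0 end.

Let edge0 (a : edge G) : edge G0 := existT _ a ord0.

Let edge0P (b : edge G0) : b = edge0 (tag b).
Proof. by case: b => a i; rewrite /edge0 /= ord1. Qed.

Let tail0 a : tail (edge0 a) = inl (tail a).
Proof. by rewrite /= /sub_tail unlift_none. Qed.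

Let head0 a : head (edge0 a) = inl (head a).
Proof.
by rewrite /= /sub_head (_ : ord0 = ord_max) ?unlift_none//; exact: val_inj.
Qed.

Let h0_edge (b : edge G0) : h0 (tail b) != h0 (head b).
Proof. by rewrite (edge0P b) tail0 head0; exact: h_edge. Qed.

(** Without added vertices, the subdivision is a copy of the graph. *)
Definition linear_mapping : pw_mapping R n G :=
  @PwMapping _ _ G (fun=> 0%N) (linear_drawing uu h0_edge).

Let reindex_edge0 (P : pred (edge G0)) (F : edge G0 -> R) :
  \sum_(b | P b) F b = \sum_(a | P (edge0 a)) F (edge0 a).
Proof.
apply: reindex; exists tag => [a _ //|b _]; by rewrite -edge0P.
Qed.

Lemma NTC_linear_mapping :
  NTC linear_mapping = pi / 2 * \sum_q `|balance h q|.
Proof.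
rewrite /NTC NTC_linear_drawing; congr (_ * _).
rewrite big_sumType/= [X in _ + X]big1 ?addr0; last by case=> a [].
apply: eq_bigr => q _; congr `|_ - _|; rewrite reindex_edge0;
  apply: eq_big => a; rewrite /rise ?tail0 ?head0//.
Qed.

End linear_mapping.

Section wheel_heights.
Context {R : realType}.
Variable m : nat.
Hypothesis m3 : (3 <= m)%N.
Notation W := (wheel m).

(** The offset by one half separates the hub from the rim vertices, [m./2]
    of which lie below it. *)
Definition wheel_height (q : vertex W) : R :=
  match q with None => (m./2)%:R - 2^-1 | Some i => (i : nat)%:R end.

Lemma nat_neq_half (i j : nat) : j%:R - 2^-1 != i%:R :> R.
Proof.
apply/eqP => h; have : (2 * j)%:R =
  (2 * i + 1)%:R :> R by rewrite natrD !natrM; lra.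
by move=> /eqP; rewrite eqr_nat => /eqP; lia.
Qed.

Lemma ordSE (i : 'I_m) : (ordS i : nat) = if i.+1 == m then 0%N else i.+1.
Proof.
rewrite /=; case: eqP => [->|im]; first exact: modnn.
by rewrite modn_small//; have := ltn_ord i; lia.
Qed.

Lemma ord_predE (i : 'I_m) :
  (ord_pred i : nat) = if (i : nat) == 0%N then m.-1 else i.-1.
Proof.
rewrite /=; case: i => i im /=; case: posnP => [->|i0].
  by rewrite add0n modn_small//; lia.
have -> : ((i + m).-1 = i.-1 + m)%N by lia.
by rewrite modnDr modn_small//; lia.
Qed.

Lemma wheel_height_edge (a : edge W) :
  wheel_height (tail a) != wheel_height (head a).
Proof.
case: a => i; first exact: nat_neq_half.
rewrite -[wheel_height _]/((i : nat)%:R) -[wheel_height _]/((ordS i : nat)%:R).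
rewrite eqr_nat ordSE; case: i => i im /=.
by case: ifP => h; apply/eqP; lia.
Qed.

Notation balance := (@balance R W wheel_height).

Lemma sg_natB (i j : nat) : Num.sg (i%:R - j%:R : R) =
  if (i < j)%N then -1 else if i == j then 0 else 1.
Proof.
case: ltngtP => [h|h|->]; last by rewrite subrr sgr0.
  by rewrite ltr0_sg// subr_lt0 ltr_nat.
by rewrite gtr0_sg// subr_gt0 ltr_nat.
Qed.

Lemma sg_hub (i : nat) : Num.sg (i%:R - ((m./2)%:R - 2^-1) : R) =
  if (i < m./2)%N then -1 else 1.
Proof.
case: ltnP => h.
  have : i%:R + 1 <= (m./2)%:R :> R by rewrite natr1 ler_nat.
  by move=> ?; rewrite ltr0_sg//; lra.
have : (m./2)%:R <= i%:R :> R by rewrite ler_nat.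
by move=> ?; rewrite gtr0_sg//; lra.
Qed.

Lemma balance_hub : `|balance None| = (odd m)%:R.
Proof.
rewrite /balance big_pred0; last by case.
rewrite big_sumType/= big_pred0_eq addr0 sub0r normrN /rise/=.
under eq_bigr do rewrite sg_hub.
have mE : m = (m./2 + (odd m + m./2))%N by have := odd_double_half m; lia.
rewrite -(big_mkord xpredT (fun i => if (i < m./2)%N then -1 else 1 : R)).
rewrite (@big_cat_nat _ _ _ m./2)//=;
  last by rewrite [X in (_ <= X)%N]mE leq_addr.
rewrite [X in X + _](@eq_big_nat _ _ _ _ _ _ (fun=> -1 : R)); last first.
  by move=> i /andP[_ ->].
rewrite [X in _ + X](@eq_big_nat _ _ _ _ _ _ (fun=> 1 : R)); last first.
  by move=> i /andP[mi _]; rewrite ltnNge mi.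
rewrite !sumr_const_nat subn0 (_ : (m - m./2 = odd m + m./2)%N); last by lia.
by rewrite mulNrn mulrnDr addrCA addNr addr0 ger0_norm.
Qed.

Lemma balance_rim (i : 'I_m) : `|balance (Some i)| =
  1 + (2 * ((i : nat) == 0%N)%:R + 2 * ((i : nat) == m.-1)%:R).
Proof.
rewrite /balance !big_sumType/=.
rewrite (big_pred1 i)//; rewrite (big_pred1 (ord_pred i)); last first.
  by move=> j /=; apply/eqP/eqP => [[<-]|->]; rewrite ?ordSK ?ord_predK.
rewrite big_pred0_eq add0r (big_pred1 i)// /rise.
change (`|Num.sg ((i : nat)%:R - ((m./2)%:R - 2^-1) : R) +
  Num.sg ((ordS (ord_pred i) : nat)%:R - (ord_pred i : nat)%:R : R) -
  Num.sg ((ordS i : nat)%:R - (i : nat)%:R : R)| =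
  1 + (2 * ((i : nat) == 0%N)%:R + 2 * ((i : nat) == m.-1)%:R)).
rewrite ord_predK sg_hub !sg_natB ord_predE ordSE; case: i => i im /=.
have [->|i0] := posnP i.
  have e1 : (0 < m./2)%N = true by lia.
  have e2 : (1 == m)%N = false by lia.
  have e3 : (0 < m.-1)%N = true by lia.
  have e4 : (0 == m.-1)%N = false by lia.
  by rewrite e1 e2 e3 e4 /= ltr0_norm; lra.
have e1 : (i < i.-1)%N = false by lia.
have e2 : (i == i.-1)%N = false by lia.
rewrite e1 e2.
have [im1|im1] := eqVneq i.+1 m.
  have e3 : (i < m./2)%N = false by lia.
  have e4 : (i == m.-1)%N = true by lia.
  by rewrite e3 e4 i0 /= gtr0_norm; lra.
have e3 : (i.+1 < i)%N = false by lia.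
have e4 : (i.+1 == i)%N = false by lia.
have e5 : (i == m.-1)%N = false by lia.
rewrite e3 e4 e5.
case: ifP => _; rewrite addrK !mulr0 !addr0.
  by rewrite normrN1.
by rewrite normr1.
Qed.

Lemma sum_indic_ord k : (k < m)%N -> \sum_(i < m) ((i : nat) == k)%:R = 1 :> R.
Proof.
move=> km; rewrite (bigD1 (Ordinal km))//= eqxx big1 ?addr0// => i.
by rewrite -val_eqE /= => /negbTE ->.
Qed.

Lemma sum_balance_wheel : \sum_q `|balance q| = (m + odd m)%:R + 4.
Proof.
rewrite (bigD1 None)//= balance_hub (reindex_omap Some id)//=; last by case.
under eq_bigr do rewrite balance_rim.
rewrite (eq_bigl xpredT); last by move=> i; rewrite eqxx.
have m0 : (0 < m)%N by lia.
have m1 : (m.-1 < m)%N by lia.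
rewrite !big_split/= -!mulr_sumr !sum_indic_ord//.
by rewrite sumr_const card_ord natrD; lra.
Qed.

End wheel_heights.

(** * The net total curvature of a wheel *)

Lemma unit_row_exists (R : realType) n : exists u : 'rV[R]_n.+1, dot u u = 1.
Proof.
exists (row_cons 1 0); rewrite dot_row_cons mulr1.
by rewrite dot0l addr0.
Qed.

Lemma ceil_half (R : realType) (m : nat) :
  (Num.ceil (m%:R / 2 : R))%:~R = (m + odd m)%:R / 2 :> R.
Proof.
have mE : m%:R + (odd m)%:R = 2 * (uphalf m)%:R :> R.
  by rewrite -natrD -natrM; congr (_ %:R); lia.
have o1 : (odd m)%:R <= 1 :> R by rewrite lern1; case: (odd m).
have o0 : 0 <= (odd m)%:R :> R by [].
rewrite (@ceil_def _ _ (Posz (uphalf m))) ?natrD.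
  by rewrite -pmulrn; lra.
by rewrite rmorphB/= -pmulrn; apply/andP; split; lra.
Qed.

Lemma inf_attained (R : realType) (S : set R) (x : R) :
  S x -> lbound S x -> inf S = x.
Proof.
move=> Sx xS; apply/eqP; rewrite eq_le; apply/andP; split.
  by apply: ge_inf => //; exists x.
by apply: lb_le_inf => //; exists x.
Qed.

Theorem corollary12 (R : realType) (m : nat) (m_ge3 : (3 <= m)%N) :
  (NTC_type R (wheel m) = pi * (2 + (Num.ceil (m%:R / 2 : R))%:~R) /\
   NTC_type_in R 3 (wheel m) = pi * (2 + (Num.ceil (m%:R / 2 : R))%:~R))%R.
Proof.
have -> : pi * (2 + (Num.ceil (m%:R / 2 : R))%:~R) =
    pi / 2 * ((m + odd m)%:R + 4) :> R by rewrite ceil_half; field.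
have lower n (f : pw_mapping R n (wheel m)) := wheel_NTC_lower_bound f m_ge3.
have [u uu] := unit_row_exists R 2.
pose f := linear_mapping uu (wheel_height_edge (R := R) m_ge3).
have fE : NTC f = pi / 2 * ((m + odd m)%:R + 4).
  by rewrite NTC_linear_mapping sum_balance_wheel.
split; apply: inf_attained.
- by exists 3%N, f.
- by move=> x [n [g ->]].
- by exists f.
- by move=> x [g ->].
Qed.
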